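(* Let $\rho>0$, $k\ge1$. Suppose that the $n$-tuple $X=(x_1,\dots,x_n)$ of self-adjoint operators in $(\mathcal{M},\tau)$ has bounded first and second order conjugate variables. Then for any $t>0$, $$\frac{1}{\rho^k}\,\Phi^*(X(t)|V_\rho)\le\frac{e^{-2(k+1)t}}{(1-e^{-2t})^k}\,\Sigma_k^*(X|V_\rho)^2,$$ where $X(t)=e^{-t}X+\sqrt{1-e^{-2t}}\,\rho^{-1/2}S$ and $S=(s_1,\dots,s_n)$ is a free $(0,1)$-semicircular $n$-tuple free from $X$.
   Context: $(\mathcal{M},\tau)$ is a tracial $W^*$-probability space (faithful normal trace) containing $X$ and $S$. $\mathbb{P}=\mathbb{C}\langle t_1,\dots,t_n\rangle$ is the $*$-algebra of noncommutative polynomials in $n$ self-adjoint variables; $V_\rho=\frac{\rho}{2}\sum_{j=1}^nt_j^2$, with cyclic gradient $\mathcal{D}V_\rho=(\rho t_1,\dots,\rho t_n)$. A free $(0,1)$-semicircular $n$-tuple consists of $n$ free semicircular variables of mean $0$ and variance $1$. The free difference quotients $\partial_j:\mathbb{P}\to\mathbb{P}\otimes\mathbb{P}^{op}$ are defined on monomials by $\partial_jm=\sum_{m=at_jb}a\otimes b$. For $P=(p_1,\dots,p_n)\in\mathbb{P}^n$: $\mathcal{J}P=(\partial_jp_i)_{i,j}$ and $\mathcal{J}^kP=\{\partial^k_{(i_1,\dots,i_k)}p_j\}_{j,i_1,\dots,i_k=1}^n$, where $\partial^k_{(i_1,\dots,i_k)}=(\partial_{i_1}\otimes id^{\otimes(k-1)})\circ(\partial_{i_2}\otimes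 id^{\otimes(k-2)})\circ\cdots\circ\partial_{i_k}$; these are evaluated at $X$ in each tensor factor. $\mathbb{T}_{(k+1,n)}(\mathcal{M}^{\otimes(k+1)})$ denotes arrays with $k+1$ indices in $\{1,\dots,n\}$ and entries in $\mathcal{M}^{\otimes(k+1)}$, with $L^2$ inner product $\langle A,B\rangle_2=\sum\tau^{\otimes(k+1)}(a_{j,i_1,\dots,i_k}b_{j,i_1,\dots,i_k}^* )$ (sum over all indices). Also $\langle X,Y\rangle_\tau=\sum_j\tau(y_j^*x_j)$. A free Stein kernel of order $k$ for $X$ with respect to $V_\rho$ is $A_k\in L^2(\mathbb{T}_{(k+1,n)}(\mathcal{M}^{\otimes(k+1)}))$ such that for every $P\in\mathbb{P}^n$ $$\langle[\mathcal{D}V_\rho](X),P(X)\rangle_\tau-(\tau\otimes\tau)\circ Tr\big(([\mathcal{J}P](X))^*\big)=\langle A_k,[\mathcal{J}^kP](X)\rangle_2,$$ and $\Sigma_k^*(X|V_\rho)=\inf_{A_k}\|A_k\|_2$ over all such kernels ($+\infty$ if there are none). Conjugate variables: $\xi_{j_1,\dots,j_m}\in L^2(W^*(X))$ is the conjugate variable of order $m$ if $\langle\xi_{j_1,\dots,j_m},p(X)\rangle_\tau=\langle1^{\otimes(m+1)},[\partial^m_{(j_1,\dots,j_m)}p](X)\rangle_2$ for all $p\in\mathbb{P}$; ''bounded first and second order conjugate variables'' means that all those of order $1$ and $2$ exist and lie in $W^*(X)$. The relative free Fisher information is $\Phi^*(X|V)=\sum_{j=1}^n\|\xi_j-[\mathcal{D}_jV](X)\|_2^2$,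 with $\xi_j$ the first-order conjugate variables of $X$ ($+\infty$ if they do not exist). *)

(* Defs.v *)
From HB Require Import structures.
From mathcomp Require Import all_boot all_order all_algebra.
From mathcomp Require Import all_classical all_reals all_analysis.
From mathcomp Require Import finmap complex.
(* The notations of monalg clash with those of MathComp-Analysis. *)
From mathcomp Require Import -(notations) monalg.

Set Implicit Arguments.
Unset Strict Implicit.
Unset Printing Implicit Defensive.

Import numFieldNormedType.Exports.
Import Order.TTheory GRing.Theory Num.Theory.

Local Open Scope classical_set_scope.
Local Open Scope complex_scope.
Local Open Scope ring_scope.

(* [ip] is linear in its first argument and conjugate-linear in the second. *)
Record hilbert (R : realType) := Hilbert {
  hilbert_sort :> completeNormedModType R[i];
  ip : {dot hilbert_sort for (@Num.conj R[i])};
  ip_norm : forall x : hilbert_sort, `|x| ^+ 2 = ip x x }.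

Definition op_commute (R : realType) (H : hilbert R) (S T : H -> H) :=
  forall x, S (T x) = T (S x).

(* A W*-algebra, presented with a faithful unital *-representation [rep] whose
   image is a von Neumann algebra: [rep_bicommutant] says that every bounded
   operator in the double commutant of the image lies in the image.  That [star]
   is a conjugate-linear anti-multiplicative involution follows from
   [rep_star] and [rep_inj]. *)
Record wstar_algebra (R : realType) := WStarAlgebra {
  wstar_sort :> algType R[i];
  star : wstar_sort -> wstar_sort;
  wstar_space : hilbert R;
  rep : wstar_sort -> {linear wstar_space -> wstar_space};
  rep_continuous : forall a, continuous (rep a);
  repD : forall a b x, rep (a + b) x = rep a x + rep b x;
  repZ : forall (c : R[i]) a x, rep (c *: a) x = c *: rep a x;
  repM : forall a b x, rep (a * b) x = rep a (rep b x);
  rep1 : forall x, rep 1 x = x;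
  rep_inj : forall a b, rep a =1 rep b -> a = b;
  rep_star : forall a x y, ip _ (rep a x) y = ip _ x (rep (star a) y);
  rep_bicommutant : forall T : {linear wstar_space -> wstar_space},
    continuous T ->
    (forall S : {linear wstar_space -> wstar_space}, continuous S ->
       (forall a, op_commute S (rep a)) -> op_commute S T) ->
    exists a, T =1 rep a }.

Definition selfadjoint (R : realType) (M : wstar_algebra R) (a : M) :=
  star a = a.

Definition op_le (R : realType) (M : wstar_algebra R) (a b : M) :=
  forall x, 0 <= ip _ (rep (b - a) x) x.

Definition op_directed (R : realType) (M : wstar_algebra R) (D : set M) :=
  D !=set0 /\
  forall a b, D a -> D b -> exists c, [/\ D c, op_le a c & op_le b c].

Definition op_lub (R : realType) (M : wstar_algebra R) (D : set M) (a : M) :=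
  (forall d, D d -> op_le d a) /\
  (forall b, (forall d, D d -> op_le d b) -> op_le a b).

(* [tr_normal] is order-continuity along bounded increasing nets; positivity and
   the trace property make [tr] real on self-adjoint elements. *)
Record tracial_wstar (R : realType) := TracialWStar {
  tracial_sort :> wstar_algebra R;
  tr : {scalar tracial_sort};
  tr1 : tr 1 = 1;
  tr_ge0 : forall a, 0 <= tr (star a * a);
  tr_faithful : forall a, tr (star a * a) = 0 -> a = 0;
  trC : forall a b, tr (a * b) = tr (b * a);
  tr_normal : forall (D : set tracial_sort) (a : tracial_sort),
    (forall d, D d -> selfadjoint d) -> selfadjoint a ->
    op_directed D -> op_lub D a ->
    forall c : R[i], (forall d, D d -> tr d <= c) -> tr a <= c }.

(* The space L^2 of the m-th tensor power of (M, tr), as the Hilbert completion of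
   the algebraic tensor power: [pure a] is the class of a_0 (x) ... (x) a_(m-1).
   Multilinearity of [pure] follows from [ip_pure], and the two axioms determine
   the space up to a unique unitary compatible with [pure].  For m = 1 it is
   L^2(M), and tensor factors carrying the opposite product give the same space. *)
Record l2_power (R : realType) (M : tracial_wstar R) (m : nat) := L2Power {
  l2_sort :> hilbert R;
  pure : ('I_m -> M) -> l2_sort;
  ip_pure : forall a b : 'I_m -> M,
    ip _ (pure a) (pure b) = \prod_(l < m) tr M (a l * star (b l));
  pure_dense : closure [set x : l2_sort | exists s : seq (R[i] * ('I_m -> M)),
    x = \sum_(u <- s) u.1 *: pure u.2] = setT }.

(* Noncommutative polynomials: the algebra over R[i] of the free monoid on 'I_n.
   The m-th tensor power has for basis the m-tuples of words. *)
Definition ncpoly (R : realType) (n : nat) := malg (fmonom 'I_n) R[i].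
Definition nctensor (R : realType) (n m : nat) :=
  malg (m.-tuple (fmonom 'I_n)) R[i].

Definition ncvar (R : realType) (n : nat) (j : 'I_n) : ncpoly R n :=
  mkmalgU (fmu j) 1.

(* The map d_i (x) id (x) ... (x) id: it splits the first word of each tuple at
   each occurrence of the letter i. *)
Definition diff_first (R : realType) (n m : nat) (i : 'I_n)
    (q : nctensor R n m.+1) : nctensor R n m.+2 :=
  \sum_(u <- msupp q)
    \sum_(l < size (thead u) | tnth (in_tuple (thead u)) l == i)
      mkmalgU [tuple of FMonom (take l (thead u))
                     :: FMonom (drop l.+1 (thead u)) :: behead u]
              (mcoeff u q).

(* d^k_(i_1, ..., i_k): d_(i_k) is applied first, then each earlier d_(i_r) on the
   leftmost tensor factor; for k = 1 it is the free difference quotient. *)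
Fixpoint diff_quot (R : realType) (n k : nat) :
    k.-tuple 'I_n -> ncpoly R n -> nctensor R n k.+1 :=
  match k with
  | 0%N => fun _ p => \sum_(w <- msupp p) mkmalgU [tuple w] (mcoeff w p)
  | k'.+1 => fun i p => diff_first (thead i) (diff_quot (behead_tuple i) p)
  end.

(* Cyclic derivative: the word a t_j b contributes b a. *)
Definition cyclic_diff (R : realType) (n : nat) (j : 'I_n) (V : ncpoly R n) :
    ncpoly R n :=
  \sum_(w <- msupp V) \sum_(l < size w | tnth (in_tuple w) l == j)
    mkmalgU (FMonom (drop l.+1 w ++ take l w)) (mcoeff w V).

Definition V_quad (R : realType) (n : nat) (rho : R) : ncpoly R n :=
  (rho / 2)%:C *: \sum_(j < n) ncvar R j ^+ 2.

Section Evaluation.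
Context {R : realType} {M : tracial_wstar R} (n : nat) (X : 'I_n -> M).

Definition eval_word (w : fmonom 'I_n) : M := \prod_(i <- w) X i.

Definition eval (p : ncpoly R n) : M :=
  \sum_(w <- msupp p) mcoeff w p *: eval_word w.

Definition evalT (m : nat) (L : l2_power M m) (q : nctensor R n m) : L :=
  \sum_(u <- msupp q)
    mcoeff u q *: pure L (fun l => eval_word (tnth u l)).

(* The value of tr (x) ... (x) tr at the adjoint q(X)^*, where
   (c a_1 (x) ... (x) a_m)^* = conj(c) a_1^* (x) ... (x) a_m^*. *)
Definition tr_adjT (m : nat) (q : nctensor R n m) : R[i] :=
  \sum_(u <- msupp q)
    Num.conj (mcoeff u q) * \prod_(l < m) tr M (star (eval_word (tnth u l))).

(* The unital subalgebra generated by X; a *-subalgebra when X is self-adjoint. *)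
Definition gen_alg : set M := range eval.

(* W*(X), for X self-adjoint: the double commutant of X. *)
Definition gen_wstar : set M := [set a |
  forall S : {linear wstar_space M -> wstar_space M}, continuous S ->
    (forall j, op_commute S (rep (X j))) -> op_commute S (rep a)].

End Evaluation.

(* The sequence s lists the factors of an alternating product, each with the
   index of its subalgebra. *)
Definition free_family (R : realType) (M : tracial_wstar R) (I : eqType)
    (A : I -> set M) :=
  forall s : seq (I * M), s != [::] ->
    sorted [rel u v | u.1 != v.1] s ->
    (forall u, u \in s -> A u.1 u.2 /\ tr M u.2 = 0) ->
    tr M (\prod_(u <- s) u.2) = 0.

Definition semicircular01 (R : realType) (M : tracial_wstar R) (s : M) :=
  selfadjoint s /\
  forall m : nat, tr M (s ^+ m) =
    (\int[lebesgue_measure]_(x in `[(-2 : R), 2])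
       (x ^+ m * (Num.sqrt (4 - x ^+ 2) / (2 * pi))))%:C.

Definition free_semicircular01 (R : realType) (M : tracial_wstar R) (n : nat)
    (S : 'I_n -> M) :=
  (forall j, semicircular01 (S j)) /\
  free_family (fun j : 'I_n => gen_alg (fun _ : 'I_1 => S j)).

Definition free_from (R : realType) (M : tracial_wstar R) (n1 n2 : nat)
    (X : 'I_n1 -> M) (S : 'I_n2 -> M) :=
  free_family (fun b : bool => if b then gen_alg X else gen_alg S).

Definition interpolate (R : realType) (M : tracial_wstar R) (n : nat) (rho t : R)
    (X S : 'I_n -> M) : 'I_n -> M := fun j =>
  (expR (- t))%:C *: X j
  + (Num.sqrt (1 - expR (- 2 * t)) * (Num.sqrt rho)^-1)%:C *: S j.

Section L2Notions.
Context {R : realType} {M : tracial_wstar R} (L2 : forall m, l2_power M m).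

Definition l2_of (a : M) : L2 1 := pure (L2 1) (fun _ => a).

Definition l2_array (n k : nat) := 'I_n -> k.-tuple 'I_n -> L2 k.+1.

Definition ip2 (n k : nat) (A B : l2_array n k) : R[i] :=
  \sum_(j < n) \sum_(i : k.-tuple 'I_n) ip (L2 k.+1) (A j i) (B j i).

Definition norm2 (n k : nat) (A : l2_array n k) : R :=
  Num.sqrt (complex.Re (ip2 A A)).

Definition jacobian_iter (n k : nat) (X : 'I_n -> M) (P : 'I_n -> ncpoly R n) :
    l2_array n k :=
  fun j i => evalT X (L2 k.+1) (diff_quot i (P j)).

Definition is_stein_kernel (n k : nat) (V : ncpoly R n) (X : 'I_n -> M)
    (A : l2_array n k) :=
  forall P : 'I_n -> ncpoly R n,
    \sum_(j < n) tr M (star (eval X (P j)) * eval X (cyclic_diff j V))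
    - \sum_(j < n) tr_adjT X (diff_quot [tuple j] (P j))
    = ip2 A (jacobian_iter X P).

Definition stein_discrepancy (n k : nat) (V : ncpoly R n) (X : 'I_n -> M) :
    \bar R :=
  ereal_inf [set (norm2 A)%:E | A in
    [set A : l2_array n k | is_stein_kernel V X A]].

(* The first conjunct says that xi lies in L^2(W*(X)). *)
Definition is_conj_var (n m : nat) (X : 'I_n -> M) (i : m.-tuple 'I_n)
    (xi : L2 1) :=
  closure [set l2_of a | a in gen_wstar X] xi /\
  forall p : ncpoly R n,
    ip (L2 1) xi (l2_of (eval X p))
    = ip (L2 m.+1) (pure (L2 m.+1) (fun _ => 1))
                   (evalT X (L2 m.+1) (diff_quot i p)).

Definition bounded_conj_vars (n m : nat) (X : 'I_n -> M) :=
  forall i : m.-tuple 'I_n,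
    exists2 a, gen_wstar X a & is_conj_var X i (l2_of a).

(* Conjugate variables are unique, so the infimum ranges over at most one value
   and is +oo when they do not exist. *)
Definition fisher_information (n : nat) (V : ncpoly R n) (X : 'I_n -> M) :
    \bar R :=
  ereal_inf [set (\sum_(j < n)
      complex.Re `|xi j - l2_of (eval X (cyclic_diff j V))| ^+ 2)%:E
    | xi in [set xi : 'I_n -> L2 1 |
        forall j, is_conj_var X [tuple j] (xi j)]].

End L2Notions.

(* Main.v *)
From HB Require Import structures.
Require Import Defs.
From mathcomp Require Import all_boot all_order all_algebra.
From mathcomp Require Import all_classical all_reals all_analysis.
From mathcomp Require Import complex finmap zify ring lra.
From mathcomp Require Import -(notations) monalg.
Import numFieldNormedType.Exports.
Import Order.TTheory GRing.Theory Num.Theory.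
(* The polynomial evaluation [eval] must hide that of function spaces. *)
Import Defs.
Local Open Scope ring_scope.

Set Implicit Arguments.
Unset Strict Implicit.
Unset Printing Implicit Defensive.

(** Put a = exp (-t) and let b > 0 satisfy rho b^2 = 1 - a^2, so that the
    interpolated variables are Y = a X + b S.  Three facts give the estimate.

    First, freeness and the moments of the semicircle law give the
    Schwinger-Dyson equation [schwinger_dyson]: multiplying a polynomial in Y and
    X by S_j acts, under the trace, as b times the free difference quotient in
    Y_j.  Hence the j-th conjugate variable xi_j of Y is the orthogonal projection
    of S_j / b on the closed span of the polynomials in Y [conj_var_exists].

    Second, let E be the conditional expectation onto the algebra of X.  For a
    word m, E[m(Y)] is an explicit polynomial q_m in X, obtained by contracting
    pairs of semicircular letters [cexp, cond_word], and the free difference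
    quotients pass through it at the cost of a factor a per derivative
    [cexp_cut, cexp_tensor]:
      d^k q_m (X) = a^k (E (x) ... (x) E) (d^k m)(Y).
    Testing the defining identity of a Stein kernel A against q_m therefore gives
      < p(Y), xi_j - rho Y_j > = - a^(k+1) sum_i < (E (x) ... (x) E)(d^k_i p)(Y), A_(j,i) >
    for every polynomial p [score_word, score_pairing].

    Third, b^k (E (x) ... (x) E)(d^k_i p)(Y) is the component of p(Y) in the k-th
    chaos of the Fock space over the algebra of X, so that
      b^(2k) sum_i |(E (x) ... (x) E)(d^k_i p)(Y)|^2 <= |p(Y)|^2    [bessel].
    The inequality is obtained without the Fock space, by iterating a one-step
    decomposition of the Gram matrix < m(Y), m'(Y) > of the words
    [gram_decomposition], which is proved by moving letters one at a time from
    one argument to the other.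

    As xi_j - rho Y_j is a limit of polynomials p(Y), the last two facts bound its
    squared norm by a^(2(k+1)) b^(-2k) sum_i |A_(j,i)|^2 [score_bound].  Summing
    over j and taking the infimum over A concludes, since
    b^(2k) = (1 - exp (-2t))^k / rho^k. *)

(** * Moments of the semicircle law *)

Section Semicircle.
Local Open Scope classical_set_scope.
Local Open Scope ring_scope.
Variable R : realType.

Let wt (x : R) : R := Num.sqrt (4 - x ^+ 2) / (2 * pi).

Definition semicircle_moment (m : nat) : R :=
  \int[lebesgue_measure]_(x in `[(-2 : R), 2])
     (x ^+ m * (Num.sqrt (4 - x ^+ 2) / (2 * pi))).

Lemma continuous_semicircle_weight : continuous wt.
Proof.
move=> x; apply: cvgM; last exact: cvg_cst.
apply: (@continuous_comp _ _ _ (fun x : R => 4 - x ^+ 2) Num.sqrt).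
  by apply: cvgB; [exact: cvg_cst | exact: exprn_continuous].
exact: sqrt_continuous.
Qed.

Lemma integrable_semicircle m :
  lebesgue_measure.-integrable `[(-2 : R), 2] (EFin \o (fun x : R => x ^+ m * wt x)).
Proof.
apply: continuous_compact_integrable; first exact: segment_compact.
apply: continuous_subspaceT => x.
by apply: cvgM; [exact: exprn_continuous | exact: continuous_semicircle_weight].
Qed.

(** The function x^m (4 - x^2)^(3/2), up to the factor 2 pi, vanishes at both ends
    of [-2, 2], and its derivative is a combination of two moment integrands: its
    integral is a linear recursion for the moments.  For m = 0 the truncated
    exponent m.-1 is harmless, its coefficient being 0. *)
Lemma is_derive_semicircle m (x : R) : -2 < x < 2 ->
  is_derive x 1 (fun x : R => x ^+ m * ((4 - x ^+ 2) * wt x))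
    (4 * m%:R * (x ^+ m.-1 * wt x) - (m%:R + 3) * (x ^+ m.+1 * wt x)).
Proof.
move=> /andP[x1 x2].
have scE (a b : R) : a *: (b : R^o) = a * b by [].
have p0 : 0 < 4 - x ^+ 2 by nra.
have s0 : Num.sqrt (4 - x ^+ 2) != 0 by rewrite gt_eqF // sqrtr_gt0.
have pi0 : pi != 0 :> R by rewrite gt_eqF // pi_gt0.
have ss : 4 - x ^+ 2 = Num.sqrt (4 - x ^+ 2) ^+ 2 by rewrite sqr_sqrtr // ltW.
have dp : is_derive x 1 (fun x : R => 4 - x ^+ 2) (- (2 * x)).
  by apply: is_derive_eq; rewrite !scE; ring.
have ds : is_derive x 1 wt (- x / Num.sqrt (4 - x ^+ 2) / (2 * pi)).
  have h := @is_derive1_comp R Num.sqrt _ x _ _ (is_derive1_sqrt p0) dp.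
  apply: (is_derive_eq (is_deriveM h (is_derive_cst ((2 * pi)^-1 : R) x 1))).
  rewrite !scE mulr0 add0r /comp /cst; move: (Num.sqrt _) s0 (pi : R) pi0 => s s0 q q0.
  by field; rewrite q0.
have dx : is_derive x 1 (fun x : R => x ^+ m) (m%:R * x ^+ m.-1).
  have := is_deriveX m (is_derive_id x (1 : R)).
  by rewrite exprfctE scE mulr1.
apply: (is_derive_eq (is_deriveM dx (is_deriveM dp ds))).
have hx : m%:R * x ^+ m = m%:R * x ^+ m.-1 * x :> R.
  by case: m {dx} => [|m]; rewrite ?mul0r //= exprSr mulrA.
rewrite !scE mulrfctE /wt exprS.
move: (Num.sqrt _) s0 ss (pi : R) pi0 => s s0 ss q q0.
transitivity (((4 - x ^+ 2) * (m%:R * x ^+ m.-1) - 3 * x * x ^+ m) * (s / (2 * q))).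
  by rewrite ss; field; rewrite q0.
transitivity ((4 * (m%:R * x ^+ m.-1) - x * (m%:R * x ^+ m) - 3 * x * x ^+ m) * (s / (2 * q))).
  by rewrite hx; ring.
by rewrite exprS; ring.
Qed.

Lemma semicircle_moment_rec m :
  (m%:R + 3) * semicircle_moment m.+1 = 4 * m%:R * semicircle_moment m.-1.
Proof.
pose F (x : R) := x ^+ m * ((4 - x ^+ 2) * wt x).
pose f (x : R) := 4 * m%:R * (x ^+ m.-1 * wt x) - (m%:R + 3) * (x ^+ m.+1 * wt x).
have cf : continuous f.
  move=> x; apply: cvgB; apply: cvgM; try exact: cvg_cst;
  by apply: cvgM; [exact: exprn_continuous | exact: continuous_semicircle_weight].
have cF : continuous F.
  move=> x; apply: cvgM; first exact: exprn_continuous.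
  apply: cvgM; last exact: continuous_semicircle_weight.
  by apply: cvgB; [exact: cvg_cst | exact: exprn_continuous].
have d2 : (-2 : R) < 2 by lra.
have h : (\int[lebesgue_measure]_(x in `[(-2 : R)%R, 2%R]) (f x)%:E =
    (F 2)%:E - (F (-2)%R)%:E)%E.
  apply: continuous_FTC2 => //.
  - exact: continuous_subspaceT.
  - split.
    + by move=> x; rewrite in_itv /= => hx; have [] := is_derive_semicircle m hx.
    + by apply: cvg_at_right_filter; exact: cF.
    + by apply: cvg_at_left_filter; exact: cF.
  - move=> x; rewrite in_itv /= => hx; rewrite derive1E.
    by have [] := is_derive_semicircle m hx.
have F0 : F 2 = 0 /\ F (-2) = 0.
  by split; rewrite /F (_ : 4 - _ = 0) ?mul0r ?mulr0 //; ring.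
have : \int[lebesgue_measure]_(x in `[(-2 : R), 2]) f x = 0.
  by rewrite /Rintegral h F0.1 F0.2 -EFinB subrr.
rewrite /f RintegralB //=; last 2 first.
- exact: (integrableZl _ _ (integrable_semicircle _)).
- exact: (integrableZl _ _ (integrable_semicircle _)).
rewrite !RintegralZl //; try exact: integrable_semicircle.
by move=> /subr0_eq ->.
Qed.

End Semicircle.

Section Convolution.
Variables (F : numFieldType) (mu : nat -> F).
Hypotheses (mu0 : mu 0%N = 1)
  (mu_rec : forall m, (m%:R + 3) * mu m.+1 = 4 * m%:R * mu m.-1).

Let d m := \sum_(i < m.+1) mu i * mu (m - i)%N.

(** By the symmetry i <-> m - i of the convolution, the weight i counts as its
    average m / 2. *)
Let weighted_sum m (c : F) :
  2 * \sum_(i < m.+1) (i%:R + c) * (mu i * mu (m - i)%N) = (m%:R + 2 * c) * d m.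
Proof.
rewrite mulr_natl mulr2n {1}(reindex_inj rev_ord_inj) -big_split /d mulr_sumr /=.
apply: eq_bigr => i _; have le_im : (i <= m)%N by rewrite -ltnS.
by rewrite subSS subKn // natrB //; ring.
Qed.

Lemma moment1_eq0 : mu 1%N = 0.
Proof.
have /eqP := mu_rec 0; rewrite mulr0 mul0r add0r mulf_eq0 pnatr_eq0 /=.
by move/eqP.
Qed.

(** Weighting the convolution d (m + 2) by i + 2 makes the linear recursion apply
    to its terms: it becomes a combination of mu (m + 2) and of d m. *)
Let conv_step m : d m = mu m.+2 -> d m.+2 = mu m.+4.
Proof.
move=> dm; have nz : m%:R + 6 != 0 :> F by rewrite -natrD pnatr_eq0 addnS.
apply: (mulfI nz).
have h4 : (m%:R + 6) * mu m.+4 = 4 * (m%:R + 3) * mu m.+2.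
  by have := mu_rec m.+3; rewrite /= -[m.+3]addn3 natrD => <-; congr (_ * _); ring.
rewrite {}h4.
have <- : (m.+2%:R + 2 * 2) = m%:R + 6 :> F by rewrite -addn2 natrD; ring.
rewrite -weighted_sum big_ord_recl big_ord_recl /= subn0 mu0.
rewrite [mu (bump _ _)]moment1_eq0 mul0r mulr0 add0r add0r mul1r.
under eq_bigr => i _.
  rewrite /bump !leq0n !add1n !subSS mulrA (_ : i.+2%:R + 2 = i.+1%:R + 3); last first.
    by rewrite -(addn2 i) -(addn1 i) !natrD; ring.
  rewrite mu_rec /= -[i.+1%:R]natr1 -!mulrA; over.
rewrite -mulr_sumr mulrDr [2 * (4 * _)]mulrCA weighted_sum dm; ring.
Qed.

(** The linear recursion determines the same sequence as the Catalan-type quadratic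
    one, which is the form that the Schwinger-Dyson equation needs. *)
Lemma moment_convolution m :
  mu m.+1 = \sum_(i < m) mu i * mu (m.-1 - i)%N.
Proof.
case: m => [|m]; first by rewrite big_ord0 moment1_eq0.
rewrite -[RHS]/(d m) /=; suff [-> _] : d m = mu m.+2 /\ d m.+1 = mu m.+3 by [].
elim: m => [|m [IH1 IH2]]; last by split=> //; exact: conv_step.
split.
  rewrite /d big_ord1 mu0 mulr1.
  have /mulfI : (1%:R + 3 : F) != 0 by rewrite -natrD pnatr_eq0.
  by apply; have := mu_rec 1; rewrite /= mu0 => ->; ring.
rewrite /d big_ord_recr big_ord1 /= moment1_eq0 mulr0 mul0r addr0.
have /mulfI : (2 + 3 : F) != 0 by rewrite -natrD pnatr_eq0.
by apply; rewrite (mu_rec 2) /= moment1_eq0; ring.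
Qed.
End Convolution.

(** * Linear extension from words to polynomials *)

Section LinearExtension.
Variables (K : choiceType) (C : nzRingType) (V : lmodType C).

(** Evaluations, traces and difference quotients of polynomials and of formal
    tensors are all of this form; [lin] being linear, they are determined by their
    values on words. *)
Definition lin (F : K -> V) (p : malg K C) : V :=
  \sum_(w <- msupp p) mcoeff w p *: F w.

(** Summing over a set larger than the support lets two polynomials be compared
    term by term. *)
Lemma lin_supset (F : K -> V) p (d : {fset K}) : (msupp p `<=` d)%fset ->
  lin F p = \sum_(w <- d) mcoeff w p *: F w.
Proof.
move=> pd; rewrite /lin; apply/esym; rewrite (big_fset_incl _ pd) //= => w _.
by move/mcoeff_outdom => ->; rewrite scale0r.
Qed.

Lemma lin_is_linear F : linear (lin F).
Proof.
move=> c p q; pose d := (msupp p `|` msupp q)%fset.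
have pd : (msupp p `<=` d)%fset by rewrite fsubsetUl.
have qd : (msupp q `<=` d)%fset by rewrite fsubsetUr.
have sd : (msupp (c *: p + q) `<=` d)%fset.
  apply: fsubset_trans (msuppD_le _ _) _.
  by rewrite fsubUset qd (fsubset_trans (msuppZ_le _ _)).
rewrite (lin_supset _ pd) (lin_supset _ qd) (lin_supset _ sd) scaler_sumr -big_split /=.
by apply: eq_bigr => w _; rewrite mcoeffD mcoeffZ scalerDl scalerA.
Qed.
HB.instance Definition _ F :=
  GRing.isLinear.Build C (malg K C) V _ (lin F) (@lin_is_linear F).

Lemma lin_monomial F w c : lin F (mkmalgU w c) = c *: F w.
Proof.
rewrite (lin_supset _ (d := [fset w]%fset)) ?big_seq_fset1 ?mcoeffUU //.
exact: msuppU_le.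
Qed.

Lemma eq_lin F G p : F =1 G -> lin F p = lin G p.
Proof. by move=> FG; apply: eq_bigr => w _; rewrite FG. Qed.

End LinearExtension.

Section Words.
Context {R : realType} {M : tracial_wstar R}.

Definition prodw (n : nat) (X : 'I_n -> M) (w : seq 'I_n) : M := \prod_(i <- w) X i.

Lemma prodw_cat n (X : 'I_n -> M) u v : prodw X (u ++ v) = prodw X u * prodw X v.
Proof. exact: big_cat. Qed.
Lemma prodw_nil n (X : 'I_n -> M) : prodw X [::] = 1.
Proof. exact: big_nil. Qed.
Lemma prodw_cons n (X : 'I_n -> M) j u : prodw X (j :: u) = X j * prodw X u.
Proof. exact: big_cons. Qed.

Lemma evalE n (X : 'I_n -> M) p : eval X p = lin (fun w : fmonom 'I_n => prodw X w) p.
Proof. by []. Qed.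

Lemma eval_monomial n (X : 'I_n -> M) w c : eval X (mkmalgU (FMonom w) c) = c *: prodw X w.
Proof. by rewrite evalE lin_monomial. Qed.

Lemma gen_alg_prodw n (X : 'I_n -> M) w : gen_alg X (prodw X w).
Proof. by exists (mkmalgU (FMonom w) 1) => //; rewrite eval_monomial scale1r. Qed.

Lemma gen_alg1 n (X : 'I_n -> M) : gen_alg X 1.
Proof. by rewrite -(prodw_nil X); exact: gen_alg_prodw. Qed.

Lemma gen_alg_gen n (X : 'I_n -> M) j : gen_alg X (X j).
Proof. by rewrite -[X j]mulr1 -(prodw_nil X) -prodw_cons; exact: gen_alg_prodw. Qed.

Lemma gen_alg_comb n (X : 'I_n -> M) c a b :
  gen_alg X a -> gen_alg X b -> gen_alg X (c *: a + b).
Proof.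
move=> [p _ <-] [q _ <-]; exists (c *: p + q) => //.
by rewrite !evalE linearP.
Qed.

Lemma gen_alg0 n (X : 'I_n -> M) : gen_alg X 0.
Proof. by exists 0 => //; rewrite evalE linear0. Qed.

Lemma gen_alg_sum n (X : 'I_n -> M) (I : Type) (s : seq I) (c : I -> R[i]) (F : I -> M) :
  (forall i, gen_alg X (F i)) -> gen_alg X (\sum_(i <- s) c i *: F i).
Proof.
by move=> h; elim/big_rec: _ => [|i a _ ha]; [exact: gen_alg0 | exact: gen_alg_comb].
Qed.

Lemma gen_algM n (X : 'I_n -> M) a b :
  gen_alg X a -> gen_alg X b -> gen_alg X (a * b).
Proof.
move=> [p _ <-] [q _ <-]; rewrite /eval mulr_suml.
under eq_bigr => w _ do rewrite -scalerAl.
apply: gen_alg_sum => w; rewrite mulr_sumr.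
under eq_bigr => v _ do rewrite -scalerAr.
by apply: gen_alg_sum => v; rewrite -prodw_cat; exact: gen_alg_prodw.
Qed.

End Words.

(** * Inner products, adjoints and the trace *)

Section Hilbert.
Context {R : realType} (H : hilbert R).
Implicit Types (x y z : H) (c : R[i]).

Lemma ipDl x y z : ip H (x + y) z = ip H x z + ip H y z.
Proof. exact: linearDl. Qed.
Lemma ipDr x y z : ip H x (y + z) = ip H x y + ip H x z.
Proof. exact: linearDr. Qed.
Lemma ipZl c x y : ip H (c *: x) y = c * ip H x y.
Proof. exact: linearZl_LR. Qed.
Lemma ipZr c x y : ip H x (c *: y) = Num.conj c * ip H x y.
Proof. exact: linearZr_LR. Qed.
Lemma ip0l x : ip H 0 x = 0.
Proof. exact: linear0l. Qed.
Lemma ip0r x : ip H x 0 = 0.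
Proof. exact: linear0r. Qed.
Lemma ipNl x y : ip H (- x) y = - ip H x y.
Proof. exact: linearNl. Qed.
Lemma ipNr x y : ip H x (- y) = - ip H x y.
Proof. exact: linearNr. Qed.
Lemma ip_suml (I : Type) (s : seq I) (P : pred I) (F : I -> H) y :
  ip H (\sum_(i <- s | P i) F i) y = \sum_(i <- s | P i) ip H (F i) y.
Proof. exact: linear_sumlz. Qed.
Lemma ip_sumr (I : Type) (s : seq I) (P : pred I) (F : I -> H) y :
  ip H y (\sum_(i <- s | P i) F i) = \sum_(i <- s | P i) ip H y (F i).
Proof. exact: linear_sumr. Qed.
Lemma ipC x y : ip H x y = Num.conj (ip H y x).
Proof. by rewrite hermC expr0 mul1r. Qed.

Lemma ip_inj x y : (forall z, ip H z x = ip H z y) -> x = y.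
Proof.
move=> xy; apply/subr0_eq/eqP; rewrite -normr_eq0 -sqrf_eq0 ip_norm.
by rewrite ipDr ipNr xy subrr.
Qed.
End Hilbert.

Section Star.
Context {R : realType} {M : wstar_algebra R}.
Implicit Types (a b : M).

(** Adjoints in a Hilbert space are unique and the representation is faithful: all
    algebraic laws of the star follow. *)
Lemma star_uniq a b :
  (forall x y, ip _ (rep a x) y = ip _ x (rep b y)) -> star a = b.
Proof.
move=> h; apply: rep_inj => y; apply: ip_inj => x.
by rewrite -rep_star h.
Qed.

Lemma starK a : star (star a) = a.
Proof. by apply: star_uniq => x y; rewrite ipC -rep_star -ipC. Qed.
Lemma starM a b : star (a * b) = star b * star a.
Proof. by apply: star_uniq => x y; rewrite !repM !rep_star. Qed.
Lemma starD a b : star (a + b) = star a + star b.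
Proof. by apply: star_uniq => x y; rewrite !repD ipDl ipDr !rep_star. Qed.
Lemma starZ c a : star (c *: a) = Num.conj c *: star a.
Proof. by apply: star_uniq => x y; rewrite !repZ ipZl ipZr conjCK rep_star. Qed.
Lemma star1 : star (1 : M) = 1.
Proof. by apply: star_uniq => x y; rewrite !rep1. Qed.
Lemma star0 : star (0 : M) = 0.
Proof. by rewrite -[X in star X](scale0r 0) starZ rmorph0 scale0r. Qed.
End Star.

Section L2One.
Context {R : realType} {M : tracial_wstar R} (L2 : forall m, l2_power M m).

Lemma ip_l2_of (a b : M) : ip _ (l2_of L2 a) (l2_of L2 b) = tr M (a * star b).
Proof. by rewrite ip_pure big_ord1. Qed.

Lemma trZ c (a : M) : tr M (c *: a) = c * tr M a.
Proof. exact: linearZ. Qed.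

(** Hermitian symmetry of the inner product of L^2(M), read on the vectors of 1
    and a. *)
Lemma tr_star (a : M) : tr M (star a) = Num.conj (tr M a).
Proof.
by have := ip_l2_of 1 a; rewrite mul1r => <-; rewrite ipC ip_l2_of star1 mulr1.
Qed.

(** The difference of the two sides is orthogonal to every vector [l2_of d], in
    particular to itself. *)
Lemma l2_of_comb c (a b : M) : l2_of L2 (c *: a + b) = c *: l2_of L2 a + l2_of L2 b.
Proof.
apply/subr0_eq/eqP; rewrite -normr_eq0 -sqrf_eq0 ip_norm.
have dl d : ip _ (l2_of L2 (c *: a + b) - (c *: l2_of L2 a + l2_of L2 b)) (l2_of L2 d) = 0.
  rewrite ipDl ipNl ipDl ipZl !ip_l2_of mulrDl linearD /= -scalerAl linearZ /=.
  by rewrite subrr.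
by rewrite ipDr ipNr ipDr ipZr !dl mulr0 addr0 subr0.
Qed.
End L2One.

(** * Functionals on free products *)

Section ReducedWords.
Variables (C : nzRingType) (I : eqType) (T : Type).
Variables (A : I -> T -> Prop) (centered : T -> Prop) (L : seq (I * T) -> C).

Definition alternating (J : eqType) (c : seq J) := sorted [rel i j | i != j] c.

Definition valid_word (w : seq (I * T)) := all (fun x => `[< A x.1 x.2 >]) w.
Definition centered_word (w : seq (I * T)) := all (fun x => `[< centered x.2 >]) w.

Lemma not_alternating w : ~~ alternating (unzip1 w) ->
  exists u c f g v, w = u ++ (c, f) :: (c, g) :: v :> seq (I * T).
Proof.
elim: w => [//|[c f] [//|[c' g] w] IH] /=.
rewrite negb_and negbK => /orP[/eqP <-|h]; first by exists [::], c, f, g, w.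
by have [u [d [f' [g' [v ->]]]]] := IH h; exists ((c, f) :: u), d, f', g', v.
Qed.

Hypothesis center : forall c f, A c f -> exists f' z, [/\ A c f', centered f' &
  forall u v, valid_word u -> valid_word v ->
    L (u ++ (c, f) :: v) = L (u ++ (c, f') :: v) + z * L (u ++ v)].
Hypothesis merge : forall c f g, A c f -> A c g -> exists2 h, A c h &
  forall u v, L (u ++ (c, f) :: (c, g) :: v) = L (u ++ (c, h) :: v).
Hypothesis reduced : forall w, alternating (unzip1 w) -> valid_word w ->
  centered_word w -> L w = 0.

(** Every product of elements of the subalgebras A_i is a linear combination of 1
    and of products in which neighbours lie in different subalgebras and all
    factors are centered.  A functional on words that respects the relations of
    the free product thus vanishes as soon as it vanishes on such reduced words.
    By induction on the length: merging equal neighbours shortens the word, and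
    splitting off the mean of a factor leaves a centered factor plus a shorter
    word; the factors are centered from left to right. *)
Lemma vanish_of_reduced w : valid_word w -> L w = 0.
Proof.
have [m] := ubnP (size w); elim: m w => [//|m IH] w; rewrite ltnS => sw vw.
have [aw|/not_alternating] := boolP (alternating (unzip1 w)); last first.
  move=> [u [c [f [g [v ew]]]]]; move: vw sw; rewrite ew /valid_word all_cat /=.
  case/and4P => vu /asboolP Af /asboolP Ag vv sw.
  have [h Ah ->] := merge Af Ag; apply: IH.
    by move: sw; rewrite !size_cat /= !addnS.
  by rewrite /valid_word all_cat /= vu vv andbT; apply/asboolP.
suff gen u v : (size (u ++ v) <= m)%N -> alternating (unzip1 (u ++ v)) ->
  valid_word u -> centered_word u -> valid_word v -> L (u ++ v) = 0.
  exact: (gen [::] w).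
elim: v u => [|[c f] v IHv] u sm auv vu cu vv.
  by rewrite cats0 in auv sm *; apply: reduced.
move: (vv); rewrite /valid_word /= => /andP[/asboolP Af vv'].
have [f' [z [Af' cf' ->]]] := center Af; last 2 first.
- by [].
- by [].
rewrite (IH (u ++ v)) ?mulr0 ?addr0; last 2 first.
- by apply: leq_trans sm; rewrite !size_cat /= addnS.
- by rewrite /valid_word all_cat -/(valid_word u) vu.
rewrite -cat_rcons; apply: IHv => //.
- by move: sm; rewrite !size_cat size_rcons /= addnS.
- by rewrite cat_rcons /unzip1 map_cat /=; rewrite /unzip1 map_cat in auv.
- by rewrite /valid_word all_rcons -/(valid_word u) vu andbT; apply/asboolP.
- by rewrite /centered_word all_rcons -/(centered_word u) cu andbT; apply/asboolP.
Qed.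
End ReducedWords.

(** * The Schwinger-Dyson equation in a free family *)

Section SchwingerDyson.
Context {R : realType} {M : tracial_wstar R}.
Local Notation C := R[i].
Local Notation letter := (M * (M -> M -> C))%type.

(** The derivative of an element v of the algebra generated by s is used only
    through the form (l, r) |-> (tr (x) tr) ((l (x) 1) (dv) (1 (x) r)).  As dv depends on
    the polynomial that represents v, a letter is an element paired with such a
    form rather than an element alone. *)
Definition bilinear_form (D : M -> M -> C) :=
  (forall c l l' r, D (c *: l + l') r = c * D l r + D l' r) /\
  (forall c l r r', D l (c *: r + r') = c * D l r + D l r').

Definition word_value (w : seq letter) : M := \prod_(f <- w) f.1.

(** The Leibniz rule for a word placed between l and r. *)
Fixpoint word_deriv (l : M) (w : seq letter) (r : M) : C :=
  if w is f :: w' then f.2 l (word_value w' * r) + word_deriv (l * f.1) w' r else 0.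

Lemma word_value_cons f w : word_value (f :: w) = f.1 * word_value w.
Proof. exact: big_cons. Qed.
Lemma word_value_cat u w : word_value (u ++ w) = word_value u * word_value w.
Proof. exact: big_cat. Qed.

Lemma word_deriv_cat l u w r : word_deriv l (u ++ w) r =
  word_deriv l u (word_value w * r) + word_deriv (l * word_value u) w r.
Proof.
elim: u l => [|f u IH] l; first by rewrite /word_value big_nil mulr1 add0r.
by rewrite /= IH word_value_cat word_value_cons !mulrA addrA.
Qed.

Fixpoint bilinear_word (w : seq letter) : Prop :=
  if w is f :: w' then bilinear_form f.2 /\ bilinear_word w' else True.

Lemma bilinear_word_cat u w :
  bilinear_word u -> bilinear_word w -> bilinear_word (u ++ w).
Proof. by elim: u => [//|f u IH] /= [hf hu] hw; split=> //; exact: IH. Qed.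

Lemma word_deriv_linl w c l l' r : bilinear_word w ->
  word_deriv (c *: l + l') w r = c * word_deriv l w r + word_deriv l' w r.
Proof.
elim: w l l' => [|f w IH] l l' /=; first by rewrite mulr0 addr0.
case=> hf hw'.
by rewrite hf.1 mulrDl -scalerAl IH // mulrDr addrACA.
Qed.

Lemma word_deriv_linr w c l r r' : bilinear_word w ->
  word_deriv l w (c *: r + r') = c * word_deriv l w r + word_deriv l w r'.
Proof.
elim: w l => [|f w IH] l /=; first by rewrite mulr0 addr0.
case=> hf hw'.
by rewrite mulrDr -scalerAr hf.2 IH // mulrDr addrACA.
Qed.

Variable s : M.

(** The Schwinger-Dyson equation at the word w says that this vanishes. *)
Definition sd_defect (w : seq letter) : C :=
  tr M (s * word_value w) - word_deriv 1 w 1.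

Lemma sd_defect_lin u c f f' g v : bilinear_word u -> bilinear_word v ->
  f.1 = c *: f'.1 + g.1 ->
  (forall l r, f.2 l r = c * f'.2 l r + g.2 l r) ->
  sd_defect (u ++ f :: v) = c * sd_defect (u ++ f' :: v) + sd_defect (u ++ g :: v).
Proof.
move=> hu hv e1 e2.
rewrite /sd_defect !word_deriv_cat !word_value_cat !word_value_cons /= e1 e2 !mul1r.
rewrite !mulrDl !mulrDr -!scalerAl -!scalerAr linearD linearZ /=.
rewrite word_deriv_linr // word_deriv_linl //.
rewrite !(mulrDr, mulrBr, opprD) -!addrA.
by ring.
Qed.

(** The form of the power s^m; the predecessor of m is only met when 0 < m. *)
Definition deriv_pow m (l r : M) : C :=
  \sum_(q < m) tr M (l * s ^+ q) * tr M (s ^+ (m.-1 - q) * r).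

Lemma deriv_powD m n l r :
  deriv_pow (m + n) l r = deriv_pow m l (s ^+ n * r) + deriv_pow n (l * s ^+ m) r.
Proof.
rewrite /deriv_pow big_split_ord /=; congr (_ + _); apply: eq_bigr => q _ /=.
  rewrite mulrA -exprD; congr (_ * tr M (s ^+ _ * r)).
  by have := ltn_ord q; lia.
rewrite -mulrA -exprD; congr (_ * tr M (s ^+ _ * r)).
by have := ltn_ord q; lia.
Qed.

Lemma deriv_pow_bilinear m : bilinear_form (deriv_pow m).
Proof.
split=> c l l' r; rewrite /deriv_pow mulr_sumr -big_split /=; apply: eq_bigr => q _.
  by rewrite mulrDl -scalerAl linearD linearZ /= mulrDl mulrA.
by rewrite mulrDr -scalerAr linearD linearZ /= mulrDr mulrCA.
Qed.

Lemma bilinear_form_suml D (J : Type) (t : seq J) (c : J -> C) (F : J -> M) r :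
  bilinear_form D -> D (\sum_(x <- t) c x *: F x) r = \sum_(x <- t) c x * D (F x) r.
Proof.
case=> Dl _; elim: t => [|x t IH]; last by rewrite !big_cons Dl IH.
by rewrite !big_nil; have := Dl (-1) 0 0 r; rewrite scaler0 addr0 mulN1r addNr.
Qed.

Lemma bilinear_form_sumr D (J : Type) (t : seq J) (c : J -> C) (F : J -> M) l :
  bilinear_form D -> D l (\sum_(x <- t) c x *: F x) = \sum_(x <- t) c x * D l (F x).
Proof.
case=> _ Dr; elim: t => [|x t IH]; last by rewrite !big_cons Dr IH.
by rewrite !big_nil; have := Dr (-1) l 0 0; rewrite scaler0 addr0 mulN1r addNr.
Qed.

Section FreeFamily.
Variables (I : eqType) (A : I -> set M) (i0 : I).
Hypotheses (A1 : forall i, A i 1)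
  (Acomb : forall i c a b, A i a -> A i b -> A i (c *: a + b))
  (Amul : forall i a b, A i a -> A i b -> A i (a * b))
  (Afree : free_family A) (As : A i0 s)
  (mom : forall m, tr M (s ^+ m.+1) =
     \sum_(q < m) tr M (s ^+ q) * tr M (s ^+ (m.-1 - q))).

Definition reduced_word (w : seq (I * M)) :=
  alternating (unzip1 w) /\ forall u, u \in w -> A u.1 u.2 /\ tr M u.2 = 0.

Lemma tr_reduced w : w != [::] -> reduced_word w -> tr M (\prod_(u <- w) u.2) = 0.
Proof. by move=> w0 [aw hw]; apply: Afree => //; rewrite /alternating sorted_map in aw. Qed.

Lemma center_closed i y : A i y -> A i (y - (tr M y) *: 1).
Proof. by move=> Ay; rewrite addrC -scaleNr; apply: Acomb. Qed.

Lemma tr_center y : tr M (y - (tr M y) *: 1) = 0.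
Proof. by rewrite linearB linearZ /= tr1 mulr1 subrr. Qed.

(** Subtract its mean from y: the centered part extends the reduced word, and the
    mean multiplies the trace of a reduced word. *)
Lemma tr_reduced_left i y j a w : A i y -> i != j -> reduced_word ((j, a) :: w) ->
  tr M (y * (a * \prod_(u <- w) u.2)) = 0.
Proof.
move=> Ay ij rw; have := @tr_reduced ((j, a) :: w) isT rw; rewrite big_cons /= => t0.
have : tr M (\prod_(u <- (i, y - tr M y *: 1) :: (j, a) :: w) u.2) = 0.
  apply: tr_reduced => //; split; first by rewrite /alternating /= ij; exact: rw.1.
  move=> u; rewrite in_cons => /orP[/eqP -> /=|]; last exact: rw.2.
  by split; [exact: center_closed | exact: tr_center].
by rewrite !big_cons /= mulrBl -scalerAl mul1r linearB linearZ /= t0 mulr0 subr0.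
Qed.

Lemma tr_reduced_right i y j a w : A i y -> j != i -> reduced_word (rcons w (j, a)) ->
  tr M ((\prod_(u <- w) u.2 * a) * y) = 0.
Proof.
move=> Ay ij rw.
have := tr_reduced _ rw; rewrite big_rcons /= -size_eq0 size_rcons => /(_ isT) t0.
have : tr M (\prod_(u <- rcons (rcons w (j, a)) (i, y - tr M y *: 1)) u.2) = 0.
  apply: tr_reduced; first by rewrite -size_eq0 size_rcons.
  split.
    have := rw.1; rewrite /alternating /unzip1 !map_rcons /=.
    case: (map fst w) => [|k v] /=; first by rewrite ij.
    by rewrite !rcons_path last_rcons /= ij andbT.
  move=> u; rewrite mem_rcons in_cons => /orP[/eqP -> /=|]; last exact: rw.2.
  by split; [exact: center_closed | exact: tr_center].
rewrite !big_rcons /= mulrBr -scalerAr mulr1 linearB linearZ /=.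
by rewrite t0 mulr0 subr0.
Qed.

(** A letter of the algebra of s carries the form of some polynomial in s; those of
    the other algebras are constants for the derivative. *)
Definition valid_letter (i : I) (f : letter) :=
  [/\ A i f.1, bilinear_form f.2 & if i == i0
    then exists p : seq (C * nat), f.1 = \sum_(x <- p) x.1 *: s ^+ x.2 /\
      forall l r, f.2 l r = \sum_(x <- p) x.1 * deriv_pow x.2 l r
    else forall l r, f.2 l r = 0].

Lemma sd_defect_unit u v :
  sd_defect (u ++ (1, fun _ _ => 0) :: v) = sd_defect (u ++ v).
Proof.
rewrite /sd_defect !word_deriv_cat !word_value_cat !word_value_cons /=.
by rewrite !(mul1r, mulr1) add0r.
Qed.

Lemma valid_bilinear_word (w : seq (I * letter)) :
  valid_word valid_letter w -> bilinear_word (unzip2 w).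
Proof.
elim: w => [//|[i f] w IH] /=.
by case/andP => /asboolP[_ hf _] /IH hw; split.
Qed.

Lemma valid_center i f : valid_letter i f -> exists f' z,
  [/\ valid_letter i f', tr M f'.1 = 0 & forall u v,
    valid_word valid_letter u -> valid_word valid_letter v ->
    sd_defect (unzip2 (u ++ (i, f) :: v)) =
      sd_defect (unzip2 (u ++ (i, f') :: v)) + z * sd_defect (unzip2 (u ++ v))].
Proof.
move=> [Af bf pf]; exists (f.1 - tr M f.1 *: 1, f.2), (tr M f.1); split.
(* A constant has derivative 0, so centering keeps the form. *)
- split=> /=; [exact: center_closed | exact: bf |].
  case: eqP pf => // _ [p [e1 e2]]; exists ((- tr M f.1, 0%N) :: p); split.
    by rewrite big_cons /= expr0 scaleNr addrC -e1.
  by move=> l r; rewrite big_cons e2 /deriv_pow big_ord0 mulr0 add0r.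
- exact: tr_center.
move=> u v vu vv; rewrite /unzip2 !map_cat /= -/(unzip2 u) -/(unzip2 v).
rewrite -(sd_defect_unit (unzip2 u) (unzip2 v)) [RHS]addrC.
apply: sd_defect_lin; try exact: valid_bilinear_word.
  by rewrite /= addrC subrK.
by move=> l r; rewrite /= mulr0 add0r.
Qed.

Lemma valid_merge i f g : valid_letter i f -> valid_letter i g ->
  exists2 h, valid_letter i h & forall u v,
    sd_defect (unzip2 (u ++ (i, f) :: (i, g) :: v)) =
    sd_defect (unzip2 (u ++ (i, h) :: v)).
Proof.
move=> [Af bf pf] [Ag bg pg].
(* The Leibniz rule for the product of two letters. *)
exists (f.1 * g.1, fun l r => f.2 l (g.1 * r) + g.2 (l * f.1) r); last first.
  move=> u v; rewrite /unzip2 !map_cat /= /sd_defect !word_deriv_cat /=.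
  by rewrite !word_value_cat !word_value_cons /= !mulrA !addrA.
split=> /=; first exact: Amul.
  split=> c l l' r; first by rewrite bf.1 mulrDl -scalerAl bg.1; ring.
  by rewrite bg.2 mulrDr -scalerAr bf.2; ring.
case: eqP pf pg => [_|_ hf hg l r]; last by rewrite hf hg addr0.
move=> [p [p1 p2]] [q [q1 q2]].
exists [seq (x.1 * y.1, (x.2 + y.2)%N) | x <- p, y <- q]; split=> [|l r].
  rewrite big_allpairs_dep p1 q1 mulr_suml; apply: eq_bigr => x _.
  rewrite mulr_sumr; apply: eq_bigr => y _ /=.
  by rewrite -scalerAl -scalerAr scalerA exprD.
have e1 x : deriv_pow x l (g.1 * r) = \sum_(y <- q) y.1 * deriv_pow x l (s ^+ y.2 * r).
  rewrite q1 mulr_suml -bilinear_form_sumr; last exact: deriv_pow_bilinear.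
  by congr (deriv_pow _ _ _); apply: eq_bigr => y _; rewrite scalerAl.
have e2 y : deriv_pow y (l * f.1) r = \sum_(x <- p) x.1 * deriv_pow y (l * s ^+ x.2) r.
  rewrite p1 mulr_sumr -bilinear_form_suml; last exact: deriv_pow_bilinear.
  by congr (deriv_pow _ _ _); apply: eq_bigr => x _; rewrite scalerAr.
rewrite big_allpairs_dep p2 q2.
transitivity (\sum_(x <- p) \sum_(y <- q) x.1 * (y.1 * deriv_pow x.2 l (s ^+ y.2 * r))
  + \sum_(x <- p) \sum_(y <- q) y.1 * (x.1 * deriv_pow y.2 (l * s ^+ x.2) r)).
  congr (_ + _); last rewrite exchange_big; apply: eq_bigr => x _.
    by rewrite e1 mulr_sumr.
  by rewrite e2 mulr_sumr.
rewrite -big_split /=; apply: eq_bigr => x _.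
rewrite -big_split /=; apply: eq_bigr => y _.
by rewrite deriv_powD; ring.
Qed.

Definition values (w : seq (I * letter)) : seq (I * M) := [seq (x.1, x.2.1) | x <- w].

Definition reduced_letters (w : seq (I * letter)) :=
  [/\ alternating (unzip1 w), valid_word valid_letter w &
      centered_word (fun f : letter => tr M f.1 = 0) w].

Lemma prod_values w : \prod_(u <- values w) u.2 = word_value (unzip2 w).
Proof. by rewrite /word_value !big_map. Qed.

Lemma reduced_values w : reduced_letters w -> reduced_word (values w).
Proof.
move=> [aw vw cw]; split; first by rewrite /unzip1 -map_comp.
elim: w vw cw {aw} => [//|x w IH] /= /andP[/asboolP[Ax _ _] vw] /andP[/asboolP cx cw] u.
by rewrite in_cons => /orP[/eqP -> //|]; exact: IH.
Qed.

Lemma reduced_cat u w :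
  reduced_letters (u ++ w) -> reduced_letters u /\ reduced_letters w.
Proof.
rewrite /reduced_letters /unzip1 map_cat /valid_word /centered_word !all_cat.
by move=> [/cat_sorted2[a1 a2] /andP[v1 v2] /andP[c1 c2]].
Qed.

Lemma pow_closed q : A i0 (s ^+ q).
Proof. by elim: q => [|q IH]; rewrite ?expr0 // exprS; exact: Amul. Qed.

(** Differentiating one letter of a reduced word leaves a reduced word times a power
    of s on the left and another one on the right.  As the word has at least two
    letters, one of the two factors is the trace of such a product with a nonempty
    reduced word, which is 0. *)
Lemma reduced_deriv_eq0 u w : (1 < size (u ++ w))%N -> reduced_letters (u ++ w) ->
  word_deriv (word_value (unzip2 u)) (unzip2 w) 1 = 0.
Proof.
elim: w u => [//|[i f] w IH] u sz ruw /=.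
have := IH (rcons u (i, f)); rewrite cat_rcons => /(_ sz ruw).
rewrite /unzip2 map_rcons -cats1 word_value_cat word_value_cons /=.
rewrite {2}/word_value big_nil mulr1 => ->.
rewrite addr0 mulr1.
have [ru riw] := reduced_cat ruw.
have [/= aw /andP[/asboolP[_ _ pf] _] _] := riw.
case: (eqVneq i i0) pf => [e|_ -> //]; rewrite {i}e in ruw riw aw sz *.
move=> [p [_ ->]]; rewrite big1 // => x _.
rewrite /deriv_pow big1 ?mulr0 // => q _.
case/lastP: u {IH} sz ru ruw => [|u [j g]] sz ru ruw.
  case: w {aw} sz riw {ruw} => [//|[j g] w] sz riw.
  have [_ rw] := reduced_cat (u := [:: _]) riw.
  have [/= /andP[ij _] _ _] := riw.
  have := reduced_values rw; rewrite /= => rv.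
  have := tr_reduced_left (pow_closed (x.2.-1 - q)) ij rv.
  by rewrite prod_values word_value_cons => ->; rewrite mulr0.
have ji : j != i0.
  have [+ _ _] := ruw; rewrite cat_rcons /unzip1 map_cat => /cat_sorted2[_] /=.
  by case/andP.
have := reduced_values ru; rewrite /values map_rcons /= => rv.
have := tr_reduced_right (pow_closed q) ji rv.
rewrite /unzip2 map_rcons -cats1 word_value_cat word_value_cons /=.
rewrite -/(values u) prod_values /word_value big_nil mulr1 => ->.
by rewrite mul0r.
Qed.

Lemma tr_pow m : tr M (s * s ^+ m) = deriv_pow m 1 1.
Proof.
rewrite -exprS mom /deriv_pow; apply: eq_bigr => q _.
by rewrite mul1r mulr1.
Qed.

(** For words of length at least 2 both terms vanish, since s can be absorbed into
    the first letter or put in front of the word; for a single power of s the equation is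
    the moment recursion of s. *)
Lemma sd_defect_reduced w : reduced_letters w -> sd_defect (unzip2 w) = 0.
Proof.
move=> rw; rewrite /sd_defect.
case: w rw => [|[i f] [|[j g] w]] rw.
- by rewrite /word_value big_nil mulr1 subr0 -[s]expr1 mom big_ord0.
- have [_ /= /andP[/asboolP[/= Af _ pf] _] _] := rw.
  rewrite word_value_cons /= /word_value !big_nil !mulr1 addr0.
  case: eqVneq pf => [_ [p [-> ->]]|i_i0 ->].
    rewrite mulr_sumr linear_sum -sumrB big1 // => x _ /=.
    by rewrite -scalerAr linearZ /= tr_pow subrr.
  rewrite subr0; have := reduced_values rw => /= rv.
  have := tr_reduced_left As _ rv; rewrite big_nil mulr1; apply.
  by rewrite eq_sym.
have -> : word_deriv 1 (unzip2 [:: (i, f), (j, g) & w]) 1 = 0.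
  have := @reduced_deriv_eq0 [::] [:: (i, f), (j, g) & w] isT rw.
  by rewrite {1}/word_value big_nil.
rewrite subr0 !word_value_cons /=.
have [/= /andP[ij _] /andP[/asboolP[Af _ _] _] _] := rw.
case: (eqVneq i i0) => [e|ni].
  rewrite mulrA; have [_ /reduced_values /= rv] := reduced_cat (u := [:: _]) rw.
  have := tr_reduced_left (Amul (_ : A i s) Af) ij rv.
  by rewrite prod_values; apply; rewrite e.
have := reduced_values rw => /= rv.
have := tr_reduced_left As _ rv; rewrite big_cons /= prod_values; apply.
by rewrite eq_sym.
Qed.

Theorem sd_defect_eq0 (w : seq (I * letter)) :
  valid_word valid_letter w -> sd_defect (unzip2 w) = 0.
Proof.
apply: (vanish_of_reduced (L := fun w => sd_defect (unzip2 w))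
  (centered := fun f : letter => tr M f.1 = 0)).
- exact: valid_center.
- exact: valid_merge.
- by move=> v av vv cv; exact: sd_defect_reduced.
Qed.

End FreeFamily.
End SchwingerDyson.

(** * Freeness of X and of the single semicirculars *)

Section Grouping.
Context {R : realType} {M : tracial_wstar R}.
Variables (n1 n2 : nat) (X : 'I_n1 -> M) (S : 'I_n2 -> M).

Definition single_alg (j : 'I_n2) : set M := gen_alg (fun _ : 'I_1 => S j).

Definition joint_alg (c : option 'I_n2) : set M :=
  if c is Some j then single_alg j else gen_alg X.

Lemma single_alg_sub j a : single_alg j a -> gen_alg S a.
Proof.
move=> [p _ <-]; apply: gen_alg_sum => w.
rewrite (_ : eval_word _ w = prodw S (nseq (size w) j)); first exact: gen_alg_prodw.
rewrite /eval_word /prodw; elim: (w : seq _) => [|i u IH]; first by rewrite !big_nil.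
by rewrite !big_cons IH.
Qed.

Lemma block_alg blk : reduced_word single_alg blk ->
  gen_alg S (\prod_(u <- blk) u.2).
Proof.
case=> _; elim: blk => [|y l IH] hl; first by rewrite big_nil; exact: gen_alg1.
rewrite big_cons; apply: gen_algM.
  by have [+ _] := hl y (mem_head _ _); exact: single_alg_sub.
by apply: IH => z zl; apply: hl; rewrite in_cons zl orbT.
Qed.

Hypotheses (XS : free_from X S) (freeS : free_family single_alg).

Let bool_alg (b : bool) : set M := if b then gen_alg X else gen_alg S.

(** Freeness is given in two layers: among the S_j, and between X and the algebra of
    all the S_j.  A reduced word in X, S_1, ..., S_n becomes one for the two algebras
    of the second layer when its maximal blocks of S-letters are multiplied out:
    by the first layer such a block is centered.  In the induction, blk is the
    still growing block at the front; the last two clauses control which letter may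
    be prepended. *)
Lemma group_blocks (s : seq (option 'I_n2 * M)) : reduced_word joint_alg s ->
  exists (blk : seq ('I_n2 * M)) (s' : seq (bool * M)),
  [/\ \prod_(u <- s) u.2 = \prod_(u <- blk) u.2 * \prod_(u <- s') u.2,
      reduced_word single_alg blk, reduced_word bool_alg s',
      ohead (unzip1 s') != Some false &
      ohead (unzip1 s) = if blk is (j, _) :: _ then Some (Some j)
                         else if s' is _ :: _ then Some None else None].
Proof.
elim: s => [_|[c v] s IH [as_ vs]].
  by exists [::], [::]; rewrite !big_nil mulr1; split.
have [Av tv] := vs (c, v) (mem_head _ _).
have rs : reduced_word joint_alg s.
  split; first by move: as_ => /path_sorted.
  by move=> u us; apply: vs; rewrite in_cons us orbT.
have [blk [s' [es rblk rs' hs' hs]]] := IH rs.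
have hc : ohead (unzip1 s) != Some c.
  case: (s) as_ => [//|[d w] t] /= /andP[cd _].
  by rewrite eq_sym; apply: contra cd => /eqP[->].
case: c Av tv hc {vs as_ IH} => [j|] /= Av tv hc.
  exists ((j, v) :: blk), s'; split=> //; first by rewrite !big_cons es mulrA.
  split=> [|u]; last by rewrite in_cons => /orP[/eqP -> //|]; exact: rblk.2.
  have := rblk.1; case: (blk) hs => [//|[i w] t] /= hs; rewrite /alternating /= => ->.
  by rewrite andbT; apply: contra hc => /eqP ->; rewrite hs.
case: blk es rblk hs => [|[i w] t] es rblk hs.
  case: s' es rs' hs' hs => [|x s'] es rs' hs' hs; last by rewrite hs eqxx in hc.
  exists [::], [:: (true, v)]; split=> //.
    by rewrite !big_cons es !big_nil /= !mulr1 mul1r.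
  by split=> // u; rewrite inE => /eqP ->.
exists [::], ((true, v) :: (false, \prod_(u <- (i, w) :: t) u.2) :: s'); split=> //.
  by rewrite !big_cons big_nil mul1r /= es big_cons.
split.
  have := rs'.1; rewrite /alternating /=.
  by case: (s') hs' => [//|[[] x] s''] //=.
move=> u; rewrite !in_cons => /or3P[/eqP -> //|/eqP -> /=|]; last exact: rs'.2.
by split; [exact: block_alg | exact: (tr_reduced freeS)].
Qed.

Lemma free_joint_alg : free_family joint_alg.
Proof.
move=> s s0 as_ hs.
have [] := @group_blocks s; first by split=> //; rewrite /alternating sorted_map.
move=> blk [s' [-> rblk rs' hs' hh]].
case: blk rblk hh => [|[i w] t] rblk hh.
  case: s' rs' hs' hh => [|x s'] rs' hs' hh; first by case: s s0 {as_ hs} hh.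
  by rewrite big_nil mul1r; exact: (tr_reduced XS).
move: (block_alg rblk) (@tr_reduced _ _ _ _ freeS ((i, w) :: t) isT rblk).
move: (\prod_(u <- (i, w) :: t) u.2) => q Sq tq.
have := @tr_reduced _ _ _ _ XS ((false, q) :: s') isT.
rewrite big_cons; apply; split.
  have := rs'.1; rewrite /alternating /=.
  by case: (s') hs' => [//|[[] x] s''] //=.
by move=> u; rewrite !in_cons => /orP[/eqP -> /=|]; [split | exact: rs'.2].
Qed.
End Grouping.

(** * Cutting words at a letter *)

Section Cut.
Variables (n : nat) (V : nmodType).
Implicit Types (F G : seq 'I_n -> seq 'I_n -> V) (m : seq 'I_n).

(** The sum of F c d over all factorizations m = c j d: the free difference quotient
    of the word m composed with a bilinear map.  The recursion follows the word, so
    that induction on words needs no manipulation of indices. *)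
Fixpoint cut (j : 'I_n) F m : V :=
  if m is i :: d then (if i == j then F [::] d else 0) + cut j (fun c => F (i :: c)) d
  else 0.

Lemma cut_ext j F G m :
  (forall c d, (size c < size m)%N -> (size d < size m)%N -> F c d = G c d) ->
  cut j F m = cut j G m.
Proof.
elim: m F G => [//|i m IH] F G FG /=; congr (_ + _).
  by case: eqP => // _; rewrite FG.
by apply: IH => c d hc hd; apply: FG => //; rewrite ltnS ltnW.
Qed.

Lemma eq_cut j F G m : (forall c d, F c d = G c d) -> cut j F m = cut j G m.
Proof. by move=> FG; apply: cut_ext. Qed.

Lemma cutD j F G m :
  cut j (fun c d => F c d + G c d) m = cut j F m + cut j G m.
Proof.
elim: m F G => [|i m IH] F G /=; first by rewrite addr0.
by rewrite IH; case: eqP => // _; rewrite ?add0r // addrACA.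
Qed.

Lemma cut0 j m : cut j (fun _ _ => 0) m = 0.
Proof. by elim: m => [//|i m IH] /=; rewrite IH addr0; case: eqP. Qed.

(** Coassociativity: both sides sum over the factorizations m = a j b i c. *)
Lemma cutA i j (F : seq 'I_n -> seq 'I_n -> seq 'I_n -> V) m :
  cut j (fun a d => cut i (fun b c => F a b c) d) m =
  cut i (fun d c => cut j (fun a b => F a b c) d) m.
Proof.
elim: m F => [//|k m IH] F /=; rewrite IH cutD.
rewrite (_ : (if k == i then 0 else 0) = 0) ?add0r; last by case: ifP.
by congr (_ + _); case: ifP; rewrite ?cut0.
Qed.
End Cut.

Lemma cut_morph n (V W : nmodType) (f : V -> W) j (F : seq 'I_n -> seq 'I_n -> V) m :
  f 0 = 0 -> {morph f : x y / x + y} ->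
  f (cut j F m) = cut j (fun c d => f (F c d)) m.
Proof.
move=> f0 fD; elim: m F => [//|i m IH] F /=.
by rewrite fD IH; case: eqP => // _; rewrite f0.
Qed.

Lemma cut_swap n (V : nmodType) i j
    (F : seq 'I_n -> seq 'I_n -> seq 'I_n -> seq 'I_n -> V) m m' :
  cut i (fun a b => cut j (fun c d => F a b c d) m') m =
  cut j (fun c d => cut i (fun a b => F a b c d) m) m'.
Proof.
elim: m F => [|k m IH] F /=; first by rewrite cut0.
by rewrite IH cutD; case: eqP; rewrite ?cut0.
Qed.

Lemma cut_sum n (V : nmodType) (I : finType) i (F : I -> seq 'I_n -> seq 'I_n -> V) m :
  cut i (fun c d => \sum_k F k c d) m = \sum_k cut i (F k) m.
Proof.
elim: m F => [|k m IH] F /=; first by rewrite big1.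
by rewrite IH big_split /=; case: ifP => // _; rewrite big1_eq.
Qed.

(** One step of the chaos expansion of a Gram kernel: both words are cut at a common
    letter, G compares the parts to the left of the cut and K the remainders. *)
Definition chain (C : nzRingType) n (G K : seq 'I_n -> seq 'I_n -> C) m m' : C :=
  \sum_(i < n) cut i (fun u d => cut i (fun u' d' => G u u' * K d d') m') m.

Section SemicircularPerturbation.
Context {R : realType} {M : tracial_wstar R}.
Variables (n : nat) (X S : 'I_n -> M).
Hypotheses (hS : free_semicircular01 S) (hXS : free_from X S).

Lemma semicircular_recursion (s : M) : semicircular01 s -> forall m,
  tr M (s ^+ m.+1) = \sum_(q < m) tr M (s ^+ q) * tr M (s ^+ (m.-1 - q)).
Proof.
move=> [_ hs] m; have hs' k : tr M (s ^+ k) = (semicircle_moment R k)%:C%C by exact: hs.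
apply: (moment_convolution (mu := fun k => tr M (s ^+ k))); first by rewrite expr0 tr1.
move=> k; rewrite !hs'; have := congr1 (real_complex R) (semicircle_moment_rec R k).
by rewrite !rmorphM rmorphD !rmorph_nat.
Qed.

Variables (a b : R[i]).
Let Y (j : 'I_n) : M := a *: X j + b *: S j.

(** [sd_defect_eq0] extends from words in X and S to Y = a X + b S, each letter
    of Y being a combination of a letter of X, which is a constant for the
    derivative in S_j, and of b S_j. *)
Theorem schwinger_dyson (j : 'I_n) m x : gen_alg X x ->
  tr M (S j * (prodw Y m * x)) =
  b * cut j (fun c d => tr M (prodw Y c) * tr M (prodw Y d * x)) m.
Proof.
move=> Xx.
pose T (l r : M) : R[i] := tr M l * tr M r.
have bT c : bilinear_form (fun l r => c * T l r).
  by split=> e l l' r; rewrite /T linearD linearZ /=; ring.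
have b0 : bilinear_form (fun _ _ : M => 0 : R[i]) by split=> *; rewrite mulr0 addr0.
pose Xl i : M * (M -> M -> R[i]) := (a *: X i, fun _ _ => 0).
pose Sl i : M * (M -> M -> R[i]) := (S i, if i == j then T else fun _ _ => 0).
pose Yl i : M * (M -> M -> R[i]) := (Y i, fun l r => if i == j then b * T l r else 0).
pose valid := valid_letter (S j) (joint_alg X S) (Some j).
have bY m' : bilinear_word (map Yl m').
  elim: m' => [//|i m' IH] /=; split=> //; case: (i == j) => //; exact: bT.
have vX i : valid None (Xl i).
  split=> //=; rewrite -[a *: _]addr0; apply: gen_alg_comb.
    exact: gen_alg_gen.
  exact: gen_alg0.
have vx : valid None (x, fun _ _ => 0) by split.
have AS i : joint_alg X S (Some i) (S i).
  exact: (gen_alg_gen (fun _ : 'I_1 => S i) ord0).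
have vS i : valid (Some i) (Sl i).
  split=> /=; first exact: AS.
    case: ifP => _ //; have := bT 1; congr bilinear_form.
    by apply/funext => l; apply/funext => r; rewrite mul1r.
  rewrite (inj_eq Some_inj); case: eqP => [->|//]; exists [:: (1, 1%N)].
  split=> [|l r]; rewrite big_seq1 ?scale1r ?expr1 //.
  by rewrite mul1r /deriv_pow big_ord1 subnn !expr0 mulr1 mul1r.
have SD w : valid_word valid w -> sd_defect (S j) (unzip2 w) = 0.
  apply: sd_defect_eq0.
  - by move=> [i|]; exact: gen_alg1.
  - by move=> [i|] c u v; exact: gen_alg_comb.
  - by move=> [i|] u v; exact: gen_algM.
  - by apply: free_joint_alg; [exact: hXS | exact: hS.2].
  - exact: AS.
  - by apply: semicircular_recursion; exact: hS.1.
(* The letters of Y are expanded one at a time, the prefix u being already expanded. *)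
have SDY m' u w : valid_word valid u -> valid_word valid w ->
    sd_defect (S j) (unzip2 u ++ map Yl m' ++ unzip2 w) = 0.
  elim: m' u => [|i m' IH] u vu vw.
    by rewrite -map_cat; apply: SD; rewrite /valid_word all_cat; apply/andP; split.
  have step (f : option 'I_n * (M * (M -> M -> R[i]))) : valid f.1 f.2 ->
      sd_defect (S j) (unzip2 u ++ f.2 :: map Yl m' ++ unzip2 w) = 0.
    move=> vf; rewrite -cat_rcons -map_rcons; apply: IH => //.
    by rewrite /valid_word all_rcons; apply/andP; split=> //; apply/asboolP.
  rewrite [map _ _]/= cat_cons.
  rewrite (@sd_defect_lin _ _ _ _ b _ (Sl i) (Xl i)).
  - by rewrite (step (Some i, Sl i) (vS i)) (step (None, Xl i) (vX i)) mulr0 addr0.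
  - exact: valid_bilinear_word vu.
  - by apply: bilinear_word_cat; [exact: bY | exact: valid_bilinear_word vw].
  - by rewrite /= addrC.
  - by move=> l r /=; rewrite addr0; case: ifP; rewrite ?mulr0.
have := SDY m [::] [:: (None, (x, fun _ _ => 0))] isT.
rewrite /= asboolT // => /(_ isT).
rewrite /sd_defect word_value_cat word_deriv_cat /= addr0.
have vY m' : word_value (map Yl m') = prodw Y m' by rewrite /word_value big_map.
rewrite vY word_value_cons /word_value big_nil !mulr1 /= => /subr0_eq ->.
suff gen l : word_deriv l (map Yl m) x =
    b * cut j (fun c d => tr M (l * prodw Y c) * tr M (prodw Y d * x)) m.
  by rewrite gen addr0; congr (_ * _); apply: eq_cut => c d; rewrite mul1r.
elim: m l => [|i m IH] l /=; first by rewrite mulr0.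
rewrite IH [RHS]mulrDr; congr (_ + _).
  by case: ifP; rewrite ?mulr0 // vY prodw_nil mulr1.
by congr (_ * _); apply: eq_cut => c d; rewrite prodw_cons mulrA.
Qed.

End SemicircularPerturbation.

Lemma cutZ (C : nzRingType) (V : lmodType C) n (k : C) i (F : seq 'I_n -> seq 'I_n -> V) m :
  cut i (fun c d => k *: F c d) m = k *: cut i F m.
Proof. by rewrite (cut_morph (f := *:%R k)) ?scaler0 //; exact: scalerDr. Qed.

(** * Conditional expectation onto the algebra of X *)

Section ConditionalExpectation.
Context (C : comNzRingType) (n : nat).
Variables (a c2 : C) (kap : seq 'I_n -> C).

(** With c2 = b^2 and kap c = tr (c(Y)), this is the linear extension of f evaluated
    at the polynomial E[m(Y)] in X.  The first letter Y_j = a X_j + b S_j of m is either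
    kept as a X_j or its S_j is contracted with a later letter of the same index,
    and then the word c in between contributes its trace.  The inner recursion is the
    sum of [cexp_cons] over the cuts of m, written so that it is structural. *)
Fixpoint cexp (V : lmodType C) (f : seq 'I_n -> V) (m : seq 'I_n) : V :=
  if m is j :: m' then
    a *: cexp (fun w => f (j :: w)) m' +
    c2 *: (fix contract (u r : seq 'I_n) : V :=
      if r is i :: d then
        (if i == j then kap u *: cexp f d else 0) + contract (rcons u i) d
      else 0) [::] m'
  else f [::].

Lemma cexp_cons (V : lmodType C) (f : seq 'I_n -> V) j m : cexp f (j :: m) =
  a *: cexp (fun w => f (j :: w)) m + c2 *: cut j (fun c d => kap c *: cexp f d) m.
Proof.
rewrite /=; congr (_ + _ *: _).
suff gen u r : (fix contract (u r : seq 'I_n) : V :=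
      if r is i :: d then
        (if i == j then kap u *: cexp f d else 0) + contract (rcons u i) d
      else 0) u r = cut j (fun c d => kap (u ++ c) *: cexp f d) r by rewrite gen.
elim: r u => [//|i d IH] u /=; rewrite IH cats0; congr (_ + _).
by apply: eq_cut => c e; rewrite cat_rcons.
Qed.

Lemma word_size_ind (P : seq 'I_n -> Prop) :
  (forall m, (forall d, (size d < size m)%N -> P d) -> P m) -> forall m, P m.
Proof.
move=> h m; have [k] := ubnP (size m); elim: k m => [//|k IH] m mk.
by apply: h => d dm; apply: IH; apply: leq_trans dm _.
Qed.

Lemma eq_cexp (V : lmodType C) (f g : seq 'I_n -> V) m :
  f =1 g -> cexp f m = cexp g m.
Proof.
elim/word_size_ind: m f g => -[|j m] IH f g fg; first exact: fg.
rewrite !cexp_cons (IH m _ _ (fun w => g (j :: w))) //; congr (_ + _ *: _).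
by apply: cut_ext => c d _ sd; rewrite (IH d _ f g) // ltnS ltnW.
Qed.

Lemma cexp_linear (V W : lmodType C) (g : V -> W) (f : seq 'I_n -> V) m :
  linear g -> g (cexp f m) = cexp (fun w => g (f w)) m.
Proof.
move=> lg; have g0 : g 0 = 0.
  by have := lg (-1) 0 0; rewrite scaler0 addr0 scaleN1r addNr.
have gD : {morph g : x y / x + y} by move=> x y; have := lg 1 x y; rewrite !scale1r.
have gZ c x : g (c *: x) = c *: g x by have := lg c x 0; rewrite g0 !addr0.
elim/word_size_ind: m f => -[|j m] IH f; first by [].
rewrite !cexp_cons gD !gZ IH //; congr (_ + _ *: _).
rewrite cut_morph //.
by apply: cut_ext => c d _ sd; rewrite gZ IH // ltnS ltnW.
Qed.

Lemma cexpD (V : lmodType C) (f g : seq 'I_n -> V) m :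
  cexp (fun w => f w + g w) m = cexp f m + cexp g m.
Proof.
elim/word_size_ind: m f g => -[|j m] IH f g; first by [].
rewrite !cexp_cons IH // scalerDr addrACA; congr (_ + _).
rewrite -scalerDr -cutD; congr (_ *: _).
by apply: cut_ext => c d _ sd; rewrite IH ?scalerDr // ltnS ltnW.
Qed.

Lemma cexp0 (V : lmodType C) m : cexp (fun _ => 0 : V) m = 0.
Proof.
elim/word_size_ind: m => -[|j m] IH; first by [].
rewrite cexp_cons IH // scaler0 add0r (@cut_ext _ _ _ _ (fun _ _ => 0)).
  by rewrite cut0 scaler0.
by move=> c d _ sd; rewrite IH ?scaler0 // ltnS ltnW.
Qed.

(** The conditional expectation is compatible with the free difference quotients:
    only the letters that are kept can be differentiated, whence the factor a, and a
    contracted pair with the differentiated letter between its two members would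
    enclose it in a trace, where it is a constant. *)
Lemma cexp_cut (V : lmodType C) i (F : seq 'I_n -> seq 'I_n -> V) m :
  cexp (cut i F) m =
  a *: cut i (fun c d => cexp (fun u => cexp (fun v => F u v) d) c) m.
Proof.
elim/word_size_ind: m F => -[|j m] IH F; first by rewrite /= scaler0.
pose cc F' c d : V := cexp (fun u => cexp (fun v => F' u v) d) c.
rewrite -/(cc F) cexp_cons [cexp _ m]cexpD IH // /=.
rewrite (@cut_ext _ _ _ _
  (fun c d => a *: cut i (fun e f => kap c *: cc F e f) d)); last first.
  move=> c d _ sd; rewrite IH; last by rewrite ltnS ltnW.
  by rewrite -/(cc F) cutZ !scalerA mulrC.
have -> : cut i (fun c d => cc F (j :: c) d) m =
    a *: cut i (cc (fun c => F (j :: c))) m +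
    c2 *: cut i (fun c d => cut j (fun e f => kap e *: cc F f d) c) m.
  by rewrite -!cutZ -cutD; apply: eq_cut => c d; rewrite /cc cexp_cons.
rewrite cutZ cutA !scalerDr addrA !scalerA (mulrC c2); congr (_ + _ + _).
by rewrite /cc /=; case: (j == i); rewrite ?cexp0.
Qed.

End ConditionalExpectation.

Section PerturbedWords.
Context {R : realType} {M : tracial_wstar R}.
Variables (L2 : forall m, l2_power M m) (n : nat) (X S : 'I_n -> M) (a b : R[i]).
Hypotheses (hS : free_semicircular01 S) (hXS : free_from X S).
Hypotheses (Xsa : forall j, selfadjoint (X j)).
Hypotheses (areal : Num.conj a = a) (breal : Num.conj b = b).

Definition perturb (j : 'I_n) : M := a *: X j + b *: S j.
Local Notation Y := perturb.

Definition kappa (m : seq 'I_n) : R[i] := tr M (prodw Y m).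

(** E[m(Y)], as an element of the algebra of X. *)
Definition cond_word (m : seq 'I_n) : M := cexp a (b ^+ 2) kappa (prodw X) m.
Local Notation e := cond_word.

Lemma cond_word_nil : e [::] = 1.
Proof. exact: prodw_nil. Qed.

Lemma cond_word_cons j m : e (j :: m) = a *: (X j * e m) +
  b ^+ 2 *: cut j (fun c d => kappa c *: e d) m.
Proof.
rewrite /e cexp_cons; congr (_ *: _ + _).
rewrite (cexp_linear _ _ _ (g := fun x : M => X j * x)).
  by apply: eq_cexp => w; exact: prodw_cons.
by move=> c x y; rewrite mulrDr -scalerAr.
Qed.

Lemma perturb_selfadjoint j : selfadjoint (Y j).
Proof.
rewrite /selfadjoint starD !starZ areal breal Xsa.
by have [/(_ j)[-> _] _] := hS.
Qed.

(** Defining property of the conditional expectation: the contraction rule of [cexp]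
    is what the Schwinger-Dyson equation does to the first semicircular letter. *)
Lemma tr_mul_cond_word x m : gen_alg X x -> tr M (x * prodw Y m) = tr M (x * e m).
Proof.
elim/word_size_ind: m x => -[|j m] IH x hx; first by rewrite prodw_nil cond_word_nil.
rewrite cond_word_cons prodw_cons mulrA /Y mulrDr -!scalerAr mulrDl -!scalerAl.
rewrite linearD !linearZ /= IH //; last by apply: gen_algM => //; exact: gen_alg_gen.
rewrite mulrDr -!scalerAr linearD !linearZ /= mulrA; congr (_ + _).
rewrite -mulrA trC -mulrA (schwinger_dyson hS hXS) // mulrA -expr2; congr (_ * _).
rewrite -/Y (cut_morph (f := fun y => tr M (x * y))) ?mulr0 ?linear0 //; last first.
  by move=> u v; rewrite mulrDr linearD.
apply: cut_ext => c d _ sd.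
by rewrite -scalerAr linearZ /= trC IH // ltnS ltnW.
Qed.

Lemma tr_cond_word m : tr M (e m) = kappa m.
Proof. by rewrite -[e m]mul1r -tr_mul_cond_word ?mul1r //; exact: gen_alg1. Qed.

Definition gram_cond (m m' : seq 'I_n) : R[i] := tr M (e m * star (e m')).
Definition gram_word (m m' : seq 'I_n) : R[i] := tr M (prodw Y m * star (prodw Y m')).
Local Notation g := gram_cond.
Local Notation h := gram_word.

Let D1 j u u' := cut j (fun c d => kappa c * g d u') u.
Let D2 j u u' := cut j (fun c d => Num.conj (kappa c) * g u d) u'.

(** Multiplication by X_j is self-adjoint, so the Gram kernel of the conditional
    expectations changes only by the contractions when a letter moves from one
    argument to the other. *)
Lemma gram_cond_move j u u' :
  g (j :: u) u' = g u (j :: u') + b ^+ 2 * (D1 j u u' - D2 j u u').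
Proof.
rewrite /g !cond_word_cons starD !starZ starM Xsa.
rewrite mulrDl mulrDr !linearD /= -!scalerAl -!scalerAr !linearZ /=.
rewrite rmorphXn /= areal breal.
rewrite -mulrA [tr M (X j * _)]trC -mulrA.
have -> : tr M (cut j (fun c d => kappa c *: e d) u * star (e u')) = D1 j u u'.
  rewrite (cut_morph (f := fun y => tr M (y * star (e u')))) ?mul0r ?linear0 //.
    by apply: eq_cut => c d; rewrite -scalerAl linearZ.
  by move=> v w; rewrite mulrDl linearD.
have -> : tr M (e u * star (cut j (fun c d => kappa c *: e d) u')) = D2 j u u'.
  rewrite (cut_morph (f := fun y => tr M (e u * star y))) ?star0 ?mulr0 ?linear0 //.
    by apply: eq_cut => c d; rewrite starZ -scalerAr linearZ.
  by move=> v w; rewrite starD mulrDr linearD.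
by rewrite -[b *: (b *: _)]/(b * (b * _)); ring.
Qed.

Lemma gram_word_move j u u' : h (j :: u) u' = h u (j :: u').
Proof.
by rewrite /h !prodw_cons starM perturb_selfadjoint -mulrA trC mulrA.
Qed.

Lemma gram_cond_nil u : g [::] u = Num.conj (kappa u) /\ g u [::] = kappa u.
Proof.
by rewrite /g cond_word_nil mul1r star1 mulr1 tr_cond_word (tr_star L2) tr_cond_word.
Qed.

Let sum_if_eq j (F : 'I_n -> R[i]) : \sum_(i < n) (if j == i then F i else 0) = F j.
Proof. by rewrite -big_mkcond /= (big_pred1 j) // => i; rewrite eq_sym. Qed.

Let cutMl i (k : R[i]) (F : seq 'I_n -> seq 'I_n -> R[i]) m :
  cut i (fun c d => k * F c d) m = k * cut i F m.
Proof. by rewrite (cut_morph (f := *%R k)) ?mulr0 //; exact: mulrDr. Qed.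

Let cutMr i (k : R[i]) (F : seq 'I_n -> seq 'I_n -> R[i]) m :
  cut i (fun c d => F c d * k) m = cut i F m * k.
Proof. by rewrite (cut_morph (f := *%R^~ k)) ?mul0r // => x y; exact: mulrDl. Qed.

Let chain_D1 j m m' : \sum_(i < n) cut i (fun u d => cut i (fun u' d' =>
    D1 j u u' * h d d') m') m = cut j (fun c y => kappa c * chain g h y m') m.
Proof.
rewrite /chain; under [RHS]eq_cut do rewrite mulr_sumr.
rewrite cut_sum; apply: eq_bigr => i _.
under [RHS]eq_cut do rewrite -cutMl.
rewrite [RHS]cutA; apply: eq_cut => u d.
under [RHS]eq_cut do rewrite -cutMl.
rewrite [RHS]cut_swap; apply: eq_cut => u' d'.
by rewrite /D1 -cutMr; apply: eq_cut => c e'; rewrite mulrA.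
Qed.

Let chain_D2 j m m' : \sum_(i < n) cut i (fun u d => cut i (fun u' d' =>
    D2 j u u' * h d d') m') m =
  cut j (fun c y => Num.conj (kappa c) * chain g h m y) m'.
Proof.
rewrite /chain; under [RHS]eq_cut do rewrite mulr_sumr.
rewrite cut_sum; apply: eq_bigr => i _.
under [RHS]eq_cut do rewrite -cutMl.
rewrite [RHS]cut_swap; apply: eq_cut => u d.
under [RHS]eq_cut do rewrite -cutMl.
rewrite [RHS]cutA; apply: eq_cut => u' d'.
by rewrite /D2 -cutMr; apply: eq_cut => c e'; rewrite mulrA.
Qed.

(** Moving a letter across [chain] produces, besides the cut at that letter, the
    contraction terms of [gram_cond_move]; by coassociativity these assemble into
    [chain] on shorter words. *)
Lemma chain_move j m m' : chain g h (j :: m) m' = chain g h m (j :: m') +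
  cut j (fun c d => Num.conj (kappa c) * (h m d - b ^+ 2 * chain g h m d)) m'
  - cut j (fun c d => kappa c * (h d m' - b ^+ 2 * chain g h d m')) m.
Proof.
pose B := \sum_(i < n) cut i (fun u d =>
  cut i (fun u' d' => g u (j :: u') * h d d') m') m.
have -> : chain g h (j :: m) m' = cut j (fun c d => Num.conj (kappa c) * h m d) m' +
    (B + b ^+ 2 * (\sum_(i < n) cut i (fun u d => cut i (fun u' d' =>
      D1 j u u' * h d d') m') m - \sum_(i < n) cut i (fun u d =>
      cut i (fun u' d' => D2 j u u' * h d d') m') m)).
  rewrite {1}/chain /= big_split /=.
  rewrite (sum_if_eq j (fun i => cut i (fun u' d' => g [::] u' * h m d') m')).
  congr (_ + _); first by apply: eq_cut => c d; rewrite (gram_cond_nil c).1.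
  rewrite /B -sumrB mulr_sumr -big_split /=; apply: eq_bigr => i _.
  rewrite -[cut i _ m - _]addrC -mulN1r -cutMl -cutD -cutMl -cutD.
  apply: eq_cut => u d; rewrite -cutMl -cutD -cutMl -cutD.
  by apply: eq_cut => u' d'; rewrite gram_cond_move; ring.
have -> : chain g h m (j :: m') = cut j (fun c d => kappa c * h d m') m + B.
  rewrite {1}/chain /=; under eq_bigr do rewrite cutD.
  rewrite big_split /=; congr (_ + _).
  under eq_cut do rewrite -(gram_cond_nil _).2.
  rewrite -[RHS](sum_if_eq j (fun i => cut i (fun u d => g u [::] * h d m') m)).
  by apply: eq_bigr => i _; case: ifP => // _; rewrite cut0.
rewrite chain_D1 chain_D2.
have sB (k : seq 'I_n -> R[i]) F G m0 : cut j (fun c d => k c * (F d - b ^+ 2 * G d)) m0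
   = cut j (fun c d => k c * F d) m0 - b ^+ 2 * cut j (fun c d => k c * G d) m0.
  by rewrite -mulNr -cutMl -cutD; apply: eq_cut => c d; ring.
by rewrite !sB; ring.
Qed.

(** First step of the chaos expansion: the part of m(Y) orthogonal to the algebra of
    X is obtained by cutting m at the first semicircular letter that is not
    contracted.  Neither side changes when a letter moves from one argument to the
    other, granted the identity for shorter words; once all letters are in the
    second argument, the identity says that E preserves the trace. *)
Theorem gram_decomposition m m' : h m m' = g m m' + b ^+ 2 * chain g h m m'.
Proof.
have [N] := ubnP (size m + size m')%N; elim: N m m' => [//|N IH] m m'.
elim: m m' => [|j m IHm] m' sz.
  rewrite /chain big1 ?mulr0 ?addr0 //.
  by rewrite (gram_cond_nil m').1 /h prodw_nil mul1r (tr_star L2).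
rewrite gram_word_move IHm; last by rewrite /= addnS -addSn.
rewrite gram_cond_move chain_move.
have z1 : cut j (fun c d => Num.conj (kappa c) * (h m d - b ^+ 2 * chain g h m d)) m'
    = D2 j m m'.
  apply: cut_ext => c d _ sd; rewrite (IH m d) ?addrK //.
  by move: sz sd; rewrite /=; lia.
have z2 : cut j (fun c d => kappa c * (h d m' - b ^+ 2 * chain g h d m')) m
    = D1 j m m'.
  apply: cut_ext => c d _ sd; rewrite (IH d m') ?addrK //.
  by move: sz sd; rewrite /=; lia.
by rewrite z1 z2; ring.
Qed.
End PerturbedWords.

(** * Iterated cuts and their Gram kernels *)

Section IteratedCut.
Variable n : nat.
Implicit Types (i : 'I_n) (t : seq 'I_n) (m : seq 'I_n).

(** The higher difference quotient along the letters t: the sum of F [:: a_0; ...; a_k]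
    over the factorizations m = a_0 t_1 a_1 ... t_k a_k. *)
Fixpoint mcut (V : nmodType) t (F : seq (seq 'I_n) -> V) m : V :=
  if t is i :: t' then cut i (fun c d => mcut t' (fun us => F (c :: us)) d) m
  else F [:: m].

Lemma mcut_ext (V : nmodType) t (F G : seq (seq 'I_n) -> V) m :
  (forall us, size us = (size t).+1 -> F us = G us) -> mcut t F m = mcut t G m.
Proof.
elim: t F G m => [|i t IH] F G m FG; first exact: FG.
by apply: eq_cut => c d; apply: IH => us us_t; apply: FG; rewrite /= us_t.
Qed.

Lemma eq_mcut (V : nmodType) t (F G : seq (seq 'I_n) -> V) m :
  F =1 G -> mcut t F m = mcut t G m.
Proof. by move=> FG; apply: mcut_ext. Qed.

Lemma mcut_morph (V W : nmodType) (f : V -> W) t (F : seq (seq 'I_n) -> V) m :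
  f 0 = 0 -> {morph f : x y / x + y} ->
  f (mcut t F m) = mcut t (fun us => f (F us)) m.
Proof.
move=> f0 fD; elim: t F m => [//|i t IH] F m /=.
by rewrite cut_morph //; apply: eq_cut => c d; rewrite IH.
Qed.

Lemma mcut_cut (V : nmodType) t i (Z : seq (seq 'I_n) -> seq 'I_n -> seq 'I_n -> V) m m' :
  mcut t (fun us => cut i (Z us) m') m =
  cut i (fun c d => mcut t (fun us => Z us c d) m) m'.
Proof.
elim: t Z m => [//|j t IH] Z m /=.
by rewrite cut_swap; apply: eq_cut => a b; rewrite IH.
Qed.

(** The letters can also be cut from the last one to the first, always in the
    leftmost factor, which is how the iterated difference quotients are defined. *)
Lemma mcut_left (V : nmodType) i t (F : seq (seq 'I_n) -> V) m :
  mcut t (fun us => cut i (fun c d => F [:: c, d & behead us]) (head [::] us)) m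
  = mcut (i :: t) F m.
Proof.
elim: t F m => [//|j t IH] F m /=.
rewrite cutA; apply: eq_cut => g f /=.
by rewrite (mcut_cut t i (fun us c d => F [:: c, d & us])).
Qed.

Lemma sum_tuple_cons (V : nmodType) k (F : k.+1.-tuple 'I_n -> V) :
  \sum_t F t = \sum_(i < n) \sum_(t : k.-tuple 'I_n) F (cons_tuple i t).
Proof.
rewrite pair_big /= (reindex (fun x : 'I_n * k.-tuple 'I_n => cons_tuple x.1 x.2)) //=.
exists (fun t : k.+1.-tuple 'I_n => (thead t, behead_tuple t)) => [[i t] _|t _] /=.
  by congr (_, _); apply: val_inj.
by rewrite [t in RHS]tuple_eta; apply: val_inj.
Qed.

Section Kernels.
Variables (C : nzRingType) (g : seq 'I_n -> seq 'I_n -> C).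

(** The inner product of two elementary tensors whose factors have Gram kernel g,
    except the last ones, which have Gram kernel K. *)
Fixpoint gram_prod (K : seq 'I_n -> seq 'I_n -> C) (us us' : seq (seq 'I_n)) : C :=
  match us, us' with
  | [:: u], [:: u'] => K u u'
  | u :: us1, u' :: us1' => g u u' * gram_prod K us1 us1'
  | _, _ => 0
  end.

Lemma eq_chain K K' : (forall m m', K m m' = K' m m') ->
  forall m m', (chain g) K m m' = (chain g) K' m m'.
Proof.
move=> KK m m'; apply: eq_bigr => i _; apply: eq_cut => u d.
by apply: eq_cut => u' d'; rewrite KK.
Qed.

(** The sum over the first letter of t is one step of [chain], and the part to the
    left of the first cut enters only through the scalar g. *)
Lemma sum_mcut_gram k K m m' :
  \sum_(t : k.-tuple 'I_n)
     mcut t (fun us => mcut t (fun us' => gram_prod K us us') m') m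
  = iter k (chain g) K m m'.
Proof.
elim: k m m' => [|k IH] m m'.
  rewrite (big_pred1 [tuple]) // => t; apply/esym/eqP; exact: tuple0.
rewrite sum_tuple_cons iterS; apply: eq_bigr => i _ /=.
rewrite -cut_sum; apply: eq_cut => c d.
under eq_bigr do rewrite (mcut_cut _ i).
rewrite -cut_sum; apply: eq_cut => c' d'.
rewrite -IH mulr_sumr; apply: eq_bigr => t _.
rewrite (mcut_morph (f := *%R (g c c'))) ?mulr0 //; last exact: mulrDr.
apply: mcut_ext => us us_t.
rewrite (mcut_morph (f := *%R (g c c'))) ?mulr0 //; last exact: mulrDr.
apply: mcut_ext => us' us'_t.
by case: us us' us_t us'_t => [//|u us] [//|u' us'].
Qed.
End Kernels.
End IteratedCut.

Section Quadratic.
Context {R : realType} {n : nat}.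
Local Notation word := (seq 'I_n).
Local Notation C := R[i].

(** For K the Gram kernel of a family of vectors this is the squared norm of the
    combination of these vectors with the coefficients of p, see [quad_ip]. *)
Definition quad (K : word -> word -> C) (p : ncpoly R n) : C :=
  \sum_(w <- msupp p) \sum_(w' <- msupp p)
    mcoeff w p * Num.conj (mcoeff w' p) * K (w : seq _) (w' : seq _).

Lemma quadD K1 K2 c p : quad (fun m m' => K1 m m' + c * K2 m m') p =
  quad K1 p + c * quad K2 p.
Proof.
rewrite /quad mulr_sumr -big_split /=; apply: eq_bigr => w _.
rewrite mulr_sumr -big_split /=; apply: eq_bigr => w' _; ring.
Qed.

Lemma eq_quad K K' p : (forall m m', K m m' = K' m m') -> quad K p = quad K' p.
Proof. by move=> KK; apply: eq_bigr => w _; apply: eq_bigr => w' _; rewrite KK. Qed.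

Lemma quad_sum (I : finType) (K : I -> word -> word -> C) p :
  quad (fun m m' => \sum_i K i m m') p = \sum_i quad (K i) p.
Proof.
rewrite /quad [RHS]exchange_big /=; apply: eq_bigr => w _.
rewrite [RHS]exchange_big /=; apply: eq_bigr => w' _; by rewrite mulr_sumr.
Qed.

Lemma quad_ip (H : hilbert R) (F : word -> H) p :
  quad (fun m m' => ip H (F m) (F m')) p =
  ip H (lin (fun w : monalg.fmonom 'I_n => F w) p) (lin (fun w : monalg.fmonom 'I_n => F w) p).
Proof.
rewrite /quad /lin ip_suml; apply: eq_bigr => w _.
rewrite ip_sumr; apply: eq_bigr => w' _; by rewrite ipZl ipZr; ring.
Qed.
End Quadratic.

(** * Elementary tensors and difference quotients in L^2 *)

Section PureTensors.
Context {R : realType} {M : tracial_wstar R} (L2 : forall m, l2_power M m).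

(** Lists suit the recursions on cuts better than functions on ordinals; all uses
    have lists of length N, so that the default value 0 is not met. *)
Definition puresq (N : nat) (s : seq M) : L2 N := pure (L2 N) (fun l => nth 0 s l).

Lemma ip_puresq N (s s' : seq M) :
  ip _ (puresq N s) (puresq N s') = \prod_(l < N) tr M (nth 0 s l * star (nth 0 s' l)).
Proof. exact: ip_pure. Qed.

Lemma ip_puresq_pure N u x w (b : 'I_N -> M) (hN : (size u < N)%N) :
  ip _ (puresq N (u ++ x :: w)) (pure (L2 N) b) =
  tr M (x * star (b (Ordinal hN))) *
  \prod_(l < N | l != Ordinal hN) tr M (nth 0 (u ++ 0 :: w) l * star (b l)).
Proof.
rewrite ip_pure (bigD1 (Ordinal hN)) //= nth_cat ltnn subnn /=; congr (_ * _).
apply: eq_bigr => l lN; rewrite !nth_cat; case: ltnP => // sl.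
case E : (l - size u)%N => [|k] //; move: lN.
by rewrite -val_eqE /= eqn_leq sl -subn_eq0 E.
Qed.

(** As for [l2_of_comb]: the difference of the two sides is orthogonal to all
    elementary tensors, hence to itself. *)
Lemma puresq_linear N u w (hN : (size u < N)%N) :
  linear (fun x : M => puresq N (u ++ x :: w)).
Proof.
move=> c x y; apply/subr0_eq/eqP; rewrite -normr_eq0 -sqrf_eq0 ip_norm.
have dl b : ip _ (puresq N (u ++ (c *: x + y) :: w) -
    (c *: puresq N (u ++ x :: w) + puresq N (u ++ y :: w))) (pure (L2 N) b) = 0.
  rewrite ipDl ipNl ipDl ipZl !(ip_puresq_pure _ _ _ hN).
  by rewrite mulrDl -scalerAl linearD linearZ /= mulrDl mulrA subrr.
by rewrite ipDr ipNr ipDr ipZr !dl mulr0 addr0 subr0.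
Qed.

(** With e the conditional expectation and v the word in Y, these are the tensors in
    which all factors but the last are already projected on the algebra of X: the
    remainders of the chaos expansion. *)
Fixpoint map_last (n : nat) (e v : seq 'I_n -> M) (us : seq (seq 'I_n)) : seq M :=
  match us with
  | [::] => [::]
  | [:: u] => [:: v u]
  | u :: us1 => e u :: map_last e v us1
  end.

Lemma map_last_map (n : nat) (e : seq 'I_n -> M) us : map_last e e us = map e us.
Proof.
elim: us => [//|u [//|u' us] IH].
by rewrite [LHS]/= -/(map_last e e (u' :: us)) IH.
Qed.

Lemma ip_puresq_gram (n : nat) (e v : seq 'I_n -> M) us us' k :
  size us = k.+1 -> size us' = k.+1 ->
  ip _ (puresq k.+1 (map_last e v us)) (puresq k.+1 (map_last e v us')) =
  gram_prod (fun u u' => tr M (e u * star (e u')))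
    (fun u u' => tr M (v u * star (v u'))) us us'.
Proof.
move=> hs hs'; rewrite ip_puresq.
elim: k us us' hs hs' => [|k IH].
  by move=> [|u []] // [|u' []] // _ _; rewrite big_ord1.
move=> [|u1 [|u2 us]] // [|u1' [|u2' us']] // [hs] [hs'].
rewrite big_ord_recl [gram_prod _ _ _ _]/=; congr (_ * _).
by rewrite -[RHS](IH (u2 :: us) (u2' :: us')) /= ?hs ?hs'.
Qed.
End PureTensors.

Section Evaluation.
Context {R : realType} {n : nat}.
Local Notation wordm := (monalg.fmonom 'I_n).

Lemma cutE (V : nmodType) i (F : seq 'I_n -> seq 'I_n -> V) m :
  cut i F m =
  \sum_(l < size m | tnth (in_tuple m) l == i) F (take l m) (drop l.+1 m).
Proof.
rewrite big_mkcond /=.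
have -> : cut i F m = \sum_(l < size m)
    (if nth i m l == i then F (take l m) (drop l.+1 m) else 0).
  elim: m F => [|k m IH] F /=; first by rewrite big_ord0.
  by rewrite big_ord_recl /= drop0 IH.
by apply: eq_bigr => l _; rewrite (tnth_nth i).
Qed.

Lemma lin_diff_first (V : lmodType R[i]) k (i : 'I_n) (q : nctensor R n k.+1)
    (F : seq (seq 'I_n) -> V) :
  lin (fun u : k.+2.-tuple wordm => F (map (@monalg.fmonom_val _) u)) (diff_first i q) =
  lin (fun u : k.+1.-tuple wordm => cut i (fun c d =>
    F [:: c, d & behead (map (@monalg.fmonom_val _) u)])
    (head [::] (map (@monalg.fmonom_val _) u))) q.
Proof.
rewrite /diff_first linear_sum; apply: eq_bigr => u _ /=.
rewrite linear_sum cutE /=; case: (tupleP u) => w t.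
rewrite theadE scaler_sumr; apply: eq_bigr => l _.
by rewrite lin_monomial.
Qed.

Lemma lin_diff_quot (V : lmodType R[i]) k (i : k.-tuple 'I_n) (p : ncpoly R n)
    (F : seq (seq 'I_n) -> V) :
  lin (fun u : k.+1.-tuple wordm => F (map (@monalg.fmonom_val _) u)) (diff_quot i p) =
  lin (fun w : wordm => mcut i F w) p.
Proof.
elim: k i F => [|k IH] i F.
  rewrite /= linear_sum; apply: eq_bigr => w _ /=; rewrite lin_monomial.
  by rewrite (tuple0 i).
rewrite [diff_quot _ _]/= lin_diff_first.
rewrite (IH _ (fun us => cut (thead i) (fun c d => F [:: c, d & behead us]) (head [::] us))).
apply: eq_lin => w; rewrite mcut_left; case: (tupleP i) => j t.
by rewrite theadE.
Qed.
End Evaluation.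

(** * The Bessel inequality *)

Section IteratedCoderivation.
Context (C : comNzRingType) (n : nat).
Variables (a c2 : C) (kap : seq 'I_n -> C).
Local Notation cexp := (cexp a c2 kap).

Lemma cexp_cutC (V : lmodType C) j (F : seq 'I_n -> seq 'I_n -> seq 'I_n -> V) c d :
  cexp (fun u => cut j (F u) d) c = cut j (fun x y => cexp (fun u => F u x y) c) d.
Proof.
elim: d F => [|i d IH] F /=; first exact: cexp0.
by rewrite cexpD IH; case: ifP => // _; rewrite cexp0.
Qed.

Lemma cexp_mcutC (V : lmodType C) t (F : seq 'I_n -> seq (seq 'I_n) -> V) c d :
  cexp (fun u => mcut t (F u) d) c = mcut t (fun us => cexp (fun u => F u us) c) d.
Proof.
elim: t F d => [//|j t IH] F d /=.
by rewrite cexp_cutC; apply: eq_cut => x y; rewrite IH.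
Qed.

(** The conditional expectation in each of several tensor factors. *)
Fixpoint mcexp (V : lmodType C) (F : seq (seq 'I_n) -> V) (us : seq (seq 'I_n)) : V :=
  if us is u :: us1 then cexp (fun w => mcexp (fun ws => F (w :: ws)) us1) u else F [::].

Lemma eq_mcexp (V : lmodType C) (F G : seq (seq 'I_n) -> V) us :
  F =1 G -> mcexp F us = mcexp G us.
Proof.
elim: us F G => [|u us IH] F G FG; first exact: FG.
by apply: eq_cexp => w; apply: IH => ws; exact: FG.
Qed.

Lemma cexp_mcut (V : lmodType C) t (F : seq (seq 'I_n) -> V) m :
  cexp (mcut t F) m = a ^+ size t *: mcut t (mcexp F) m.
Proof.
elim: t F m => [|j t IH] F m; first by rewrite /= scale1r.
rewrite /= cexp_cut exprS -scalerA; congr (_ *: _).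
rewrite -cutZ; apply: eq_cut => c d.
under eq_cexp do rewrite IH.
rewrite -(cexp_linear _ _ _ (g := *:%R (a ^+ size t))); last first.
  by move=> k x y; rewrite scalerDr !scalerA mulrC.
by rewrite cexp_mcutC.
Qed.
End IteratedCoderivation.

Section Bessel.
Context {R : realType} {M : tracial_wstar R}.
Variables (L2 : forall m, l2_power M m) (n : nat) (X S : 'I_n -> M) (a b : R[i]).
Hypotheses (hS : free_semicircular01 S) (hXS : free_from X S).
Hypotheses (Xsa : forall j, selfadjoint (X j)).
Hypotheses (areal : Num.conj a = a) (breal : Num.conj b = b).

Local Notation Y := (perturb X S a b).
Local Notation e := (cond_word X S a b).
Local Notation kap := (kappa X S a b).
Local Notation g := (gram_cond X S a b).
Local Notation h := (gram_word X S a b).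

Lemma mcexp_puresq N s us : (size s + size us <= N)%N ->
  mcexp a (b ^+ 2) kap (fun ws => puresq L2 N (s ++ map (prodw X) ws)) us =
  puresq L2 N (s ++ map e us).
Proof.
elim: us s => [//|u us IH] s /=; rewrite addnS -addSn => sN.
under eq_cexp => w.
  under eq_mcexp do rewrite /= -cat_rcons.
  rewrite IH ?size_rcons // cat_rcons; over.
rewrite -(cexp_linear _ _ _ (g := fun x => puresq L2 N (s ++ x :: map e us))) //.
by apply: puresq_linear; apply: leq_trans sN; rewrite ltnS leq_addr.
Qed.

(** The k-th difference quotient of E[m(Y)], evaluated at X in L^2, is a^k times the
    tensor power of E applied to that of m(Y). *)
Lemma cexp_tensor k (t : k.-tuple 'I_n) m :
  cexp a (b ^+ 2) kap
    (mcut t (fun us => puresq L2 k.+1 (map (prodw X) us))) m =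
  a ^+ k *: mcut t (fun us => puresq L2 k.+1 (map e us)) m.
Proof.
rewrite cexp_mcut size_tuple; congr (_ *: _); apply: mcut_ext => us us_t.
by rewrite (mcexp_puresq (s := [::])) //= us_t size_tuple.
Qed.

Let W k (v : seq 'I_n -> M) (t : k.-tuple 'I_n) (m : seq 'I_n) : L2 k.+1 :=
  mcut t (fun us => puresq L2 k.+1 (map_last e v us)) m.

Lemma sum_ip_tensor k v m m' :
  \sum_(t : k.-tuple 'I_n) ip _ (W v t m) (W v t m') =
  iter k (chain g) (fun u u' => tr M (v u * star (v u'))) m m'.
Proof.
rewrite -sum_mcut_gram; apply: eq_bigr => t _.
rewrite (mcut_morph (f := fun x => ip _ x (W v t m'))); last 2 first.
- exact: ip0l.
- by move=> x y; rewrite ipDl.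
apply: mcut_ext => us us_t.
rewrite (mcut_morph (f := fun y => ip _ _ y)); last 2 first.
- exact: ip0r.
- by move=> x y; rewrite ipDr.
apply: mcut_ext => us' us'_t.
by rewrite ip_puresq_gram ?us_t ?us'_t ?size_tuple.
Qed.

(** Iterating [chain] on a Gram kernel gives again a Gram kernel, that of a family of
    tensors. *)
Lemma quad_chain_ge0 k v (p : ncpoly R n) :
  0 <= quad (iter k (chain g) (fun u u' => tr M (v u * star (v u')))) p.
Proof.
rewrite -(eq_quad _ (@sum_ip_tensor k v)) quad_sum; apply: sumr_ge0 => t _.
by rewrite quad_ip -ip_norm exprn_ge0.
Qed.

Lemma chain_lin K1 K2 c : forall m m',
  chain g (fun u u' => K1 u u' + c * K2 u u') m m' = chain g K1 m m' + c * chain g K2 m m'.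
Proof.
move=> m m'; rewrite /chain mulr_sumr -big_split /=; apply: eq_bigr => i _.
rewrite (cut_morph (f := *%R c)) ?mulr0 //; last exact: mulrDr.
rewrite -cutD; apply: eq_cut => u d.
rewrite (cut_morph (f := *%R c)) ?mulr0 //; last exact: mulrDr.
rewrite -cutD; apply: eq_cut => u' d'; ring.
Qed.

Lemma iter_chain_decomposition k m m' : iter k (chain g) h m m' =
  iter k (chain g) g m m' + b ^+ 2 * iter k.+1 (chain g) h m m'.
Proof.
elim: k m m' => [|k IH] m m'.
  by rewrite /= (gram_decomposition L2 hS hXS Xsa areal breal).
rewrite !iterS -chain_lin; exact: eq_chain.
Qed.

(** Iterating [gram_decomposition] splits the Gram kernel of the words into k chaos
    components and a remainder; all are Gram kernels, so that each component is
    bounded by the whole. *)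
Theorem bessel k (p : ncpoly R n) (b0 : 0 <= b) :
  b ^+ (2 * k) * (\sum_(t : k.-tuple 'I_n)
    `|lin (fun w : monalg.fmonom 'I_n =>
        mcut t (fun us => puresq L2 k.+1 (map e us)) w) p| ^+ 2)
  <= `|l2_of L2 (eval Y p)| ^+ 2.
Proof.
have q0 : `|l2_of L2 (eval Y p)| ^+ 2 = quad h p.
  have eE : l2_of L2 (eval Y p) = lin (fun w : monalg.fmonom 'I_n => l2_of L2 (prodw Y w)) p.
    rewrite evalE /lin; apply: (big_rec2 (fun x y => l2_of L2 x = y)) => [|w y1 y2 _ <-].
      have := l2_of_comb L2 (-1) 0 0; rewrite scaler0 addr0 scaleN1r addNr; exact.
    by rewrite l2_of_comb.
  rewrite ip_norm eE -(quad_ip (fun w => l2_of L2 (prodw Y w))).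
  by apply: eq_quad => m m'; rewrite ip_l2_of.
rewrite q0; under eq_bigr do rewrite ip_norm -(quad_ip (mcut _ _)).
rewrite -quad_sum.
have -> : quad (fun m m' => \sum_(t : k.-tuple 'I_n) ip _
    (mcut t (fun us => puresq L2 k.+1 (map e us)) m)
    (mcut t (fun us => puresq L2 k.+1 (map e us)) m')) p
    = quad (iter k (chain g) g) p.
  apply: eq_quad => m m'; rewrite -(@sum_ip_tensor k e); apply: eq_bigr => t _.
  by congr (ip _ _ _); apply: eq_mcut => us; rewrite map_last_map.
have b2 : 0 <= b ^+ 2 by exact: exprn_ge0.
have step i : quad (iter i (chain g) h) p =
    quad (iter i (chain g) g) p + b ^+ 2 * quad (iter i.+1 (chain g) h) p.
  by rewrite -quadD; apply: eq_quad => m m'; exact: iter_chain_decomposition.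
have le1 : quad (iter k (chain g) g) p <= quad (iter k (chain g) h) p.
  by rewrite step lerDl mulr_ge0 // (quad_chain_ge0 k.+1 (prodw Y)).
have le2 : b ^+ (2 * k) * quad (iter k (chain g) h) p <= quad h p.
  elim: k {le1} => [|k IH]; first by rewrite mul1r.
  apply: le_trans IH; rewrite mulnS exprD -mulrA mulrCA; apply: ler_wpM2l.
    exact: exprn_ge0.
  by rewrite (step k) lerDr (quad_chain_ge0 k e).
by apply: le_trans le2; apply: ler_wpM2l => //; exact: exprn_ge0.
Qed.
End Bessel.

(** * Orthogonal projections *)

Section ComplexNorm.
Local Open Scope classical_set_scope.
Local Open Scope ring_scope.
Context {R : realType}.

Lemma ge0_ReE (z : R[i]) : 0 <= z -> z = (complex.Re z)%:C%C.
Proof. by case: z => u v; rewrite lecE /= => /andP[/eqP -> _]. Qed.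

Lemma conjR (k : R) : Num.conj (k%:C%C : R[i]) = k%:C%C.
Proof. by apply: conj_Creal; rewrite realE !lecE /= eqxx; exact: le_total. Qed.

Context (H : hilbert R).
Implicit Types (u v x y z : H).

(** Norms take values in R[i], where only real numbers are comparable; infima and
    linear arithmetic need their real part. *)
Definition sqn x : R := complex.Re (`|x| ^+ 2).

Lemma sqnE x : `|x| ^+ 2 = (sqn x)%:C%C.
Proof. by apply: ge0_ReE; rewrite exprn_ge0. Qed.

Lemma sqn_ge0 x : 0 <= sqn x.
Proof. by rewrite -lecR -sqnE exprn_ge0. Qed.

Lemma norm_lt_sqn x (r : R) : 0 < r -> (`|x| < r%:C%C) = (sqn x < r ^+ 2).
Proof.
move=> r0; rewrite -ltcR -sqnE rmorphXn /= ltr_pXn2r // ?nnegrE //.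
by rewrite lecR ltW.
Qed.

Lemma parallelogram u v : sqn (u + v) + sqn (u - v) = 2 * (sqn u + sqn v).
Proof.
apply: (@complexI R); rewrite rmorphM rmorph_nat !rmorphD /= -!sqnE !ip_norm.
by rewrite !(ipDl, ipDr, ipNl, ipNr); ring.
Qed.

Lemma sqnZ (k : R) x : sqn (k%:C%C *: x) = k ^+ 2 * sqn x.
Proof.
apply: (@complexI R); rewrite rmorphM rmorphXn /= -!sqnE !ip_norm ipZl ipZr.
by rewrite conjR; ring.
Qed.

Lemma closure_approx (D : set H) x : closure D x <->
  forall e : R, 0 < e -> exists2 z, D z & sqn (x - z) < e.
Proof.
split=> [cx e e0|h B /nbhs_ballP[e /= e0 eB]].
  have se0 : 0 < Num.sqrt e by rewrite sqrtr_gt0.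
  have e0' : 0 < (Num.sqrt e)%:C%C :> R[i] by rewrite ltcR.
  have [z [Dz]] := cx _ (nbhsx_ballx x _ e0').
  by rewrite -ball_normE /= norm_lt_sqn // sqr_sqrtr ?ltW //; exists z.
have eE := ge0_ReE (ltW e0).
have r0 : 0 < complex.Re e by rewrite -ltcR -eE.
have [z Dz xz] := h _ (exprn_gt0 2 r0).
exists z; split=> //; apply: eB.
by rewrite -ball_normE /= eE norm_lt_sqn.
Qed.

(** With D = 0 this is the Cauchy-Schwarz inequality; with D the squared distance to
    a subspace it says that the residual u of a nearly optimal approximation is
    nearly orthogonal to the subspace. *)
Lemma norm_ip_le (D : R) u v :
  (forall c : R[i], D <= sqn (u - c *: v)) ->
  `|ip H u v| ^+ 2 <= (sqn u - D)%:C%C * (sqn v)%:C%C.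
Proof.
move=> h; have [->|v0] := eqVneq v 0.
  by rewrite ip0r normr0 expr0n /= mulr_ge0 // lecE /= eqxx /= ?sqn_ge0 // subr_ge0;
     have := h 0; rewrite scale0r subr0.
have vv0 : 0 < ip H v v by rewrite -ip_norm exprn_gt0 // normr_gt0.
have vvr : Num.conj (ip H v v) = ip H v v by rewrite -ipC.
(* The coefficient that minimizes the right-hand side of the hypothesis. *)
have := h (ip H u v / ip H v v); rewrite -lecR -(sqnE (u - _)) ip_norm.
rewrite !(ipDl, ipDr, ipNl, ipNr, ipZl, ipZr) rmorphM /= fmorphV /=. rewrite vvr.
rewrite (ipC v u) -(sqnE v) ip_norm rmorphB /= -(sqnE u) ip_norm normCK.
set w := ip H u v; set n := ip H v v => hh.
have n0 : n != 0 by rewrite gt_eqF.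
rewrite mulrBl lerBrDr -lerBrDl; have := ler_wpM2r (ltW vv0) hh.
by rewrite -/n; congr (_ <= _); field.
Qed.
End ComplexNorm.

Section Projection.
Local Open Scope classical_set_scope.
Local Open Scope ring_scope.
Context {R : realType} (H : hilbert R).
Variables (D : set H) (x : H).
Hypotheses (D0 : D 0) (Dlin : forall c u v, D u -> D v -> D (c *: u + v)).

(** Minimizing sequences are Cauchy by the parallelogram identity; their limit lies
    in the closure of D, and the residual is orthogonal to D by [norm_ip_le]. *)
Lemma orthogonal_projection :
  exists2 xi, closure D xi & forall z, D z -> ip H (x - xi) z = 0.
Proof.
pose E := [set sqn (x - z) | z in D].
have lbE : has_lbound E by exists 0 => _ [z _ <-]; exact: sqn_ge0.
have infE : has_inf E by split=> //; exists (sqn (x - 0)), 0.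
pose d := inf E.
have dle z : D z -> d <= sqn (x - z) by move=> Dz; apply: ge_inf => //; exists z.
have /choice[z hz] : forall n : nat, exists z, D z /\ sqn (x - z) < d + n.+1%:R^-1.
  move=> n; have n0 : 0 < n.+1%:R^-1 :> R by rewrite invr_gt0.
  by have [_ [z Dz <-] hz] := inf_adherent n0 infE; exists z.
have zclose m n : sqn (z m - z n) <= 2 * (m.+1%:R^-1 + n.+1%:R^-1).
  have := parallelogram (x - z m) (x - z n).
  have -> : x - z m - (x - z n) = - (z m - z n) by rewrite !opprD !opprK addrACA subrr add0r.
  have -> : x - z m + (x - z n) = (2 : R)%:C%C *: (x - (2^-1 : R)%:C%C *: (z m + z n)).
    rewrite scalerBr scalerA -rmorphM /= divff // scale1r opprD addrACA.
    by rewrite rmorph_nat scaler_nat mulr2n.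
  rewrite sqnZ; have /dle : D ((2^-1 : R)%:C%C *: (z m + z n)).
    rewrite -[_ *: _]addr0; apply: Dlin => //; rewrite -[z m]scale1r.
    by apply: Dlin; [have [] := hz m | have [] := hz n].
  have -> : sqn (- (z m - z n)) = sqn (z m - z n) by rewrite /sqn normrN.
  have [_] := hz m; have [_] := hz n.
  move: (m.+1%:R^-1) (n.+1%:R^-1) (sqn _) (sqn _) (sqn _) (sqn _) => p q u1 u2 u3 u4.
  lra.
have cz : cvg (z @ \oo).
  apply: cauchy_cvg; apply/cauchyP => e e0.
  have eE := ge0_ReE (ltW e0).
  have r0 : 0 < complex.Re e by rewrite -ltcR -eE.
  have q0 : 0 < complex.Re e ^+ 2 / 4 by rewrite divr_gt0 // exprn_gt0.
  have [N hN] : exists N : nat, N.+1%:R^-1 < complex.Re e ^+ 2 / 4.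
    exists (Num.truncn (complex.Re e ^+ 2 / 4)^-1).
    rewrite invf_plt ?posrE // ?ltr0n //.
    by have := truncnS_gt (complex.Re e ^+ 2 / 4)^-1.
  exists (z N); exists N => // n /= Nn.
  rewrite -ball_normE /= eE norm_lt_sqn //; apply: le_lt_trans (zclose _ _) _.
  have : n.+1%:R^-1 <= N.+1%:R^-1 :> R by rewrite lef_pV2 ?posrE ?ltr0n // ler_nat.
  by move: (n.+1%:R^-1) (N.+1%:R^-1) hN => p q; lra.
have small (e : R) : 0 < e -> exists n,
    sqn (x - z n) - d <= e /\ sqn (z n - lim (z @ \oo)) <= e.
  move=> e0; have e0' : 0 < (Num.sqrt e)%:C%C :> R[i] by rewrite ltcR sqrtr_gt0.
  have [N _ hN] := cz _ (nbhsx_ballx _ _ e0').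
  pose K := Num.truncn e^-1.
  exists (maxn N K); split.
    have [_ /ltW] := hz (maxn N K); rewrite -lerBlDl => h; apply: le_trans h _.
    apply: ltW; rewrite invf_plt ?posrE // ?ltr0n //.
    apply: lt_le_trans (truncnS_gt _) _; rewrite ler_nat ltnS; exact: leq_maxr.
  have := hN _ (leq_maxl N K).
  rewrite -ball_normE /= norm_lt_sqn ?sqrtr_gt0 // sqr_sqrtr; last exact: ltW.
  by move/ltW; rewrite /sqn distrC.
exists (lim (z @ \oo)).
  move=> B nB; have [N _ hN] := cz B nB.
  by exists (z N); split; [have [] := hz N | exact: hN (leqnn N)].
move=> v Dv; set w := ip H _ v.
have bound (e : R) : 0 < e -> `|w| <= (2 * Num.sqrt (e * sqn v))%:C%C.
  move=> e0; have [n [h1 h2]] := small e e0.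
  have -> : w = ip H (x - z n) v + ip H (z n - lim (z @ \oo)) v.
    by rewrite -ipDl addrA subrK.
  have root (y : R[i]) : `|y| ^+ 2 <= (e * sqn v)%:C%C -> `|y| <= (Num.sqrt (e * sqn v))%:C%C.
    have ev : 0 <= e * sqn v by rewrite mulr_ge0 ?sqn_ge0 // ltW.
    rewrite -{1}(sqr_sqrtr ev) rmorphXn /= ler_pXn2r // ?nnegrE //.
    by rewrite lecR sqrtr_ge0.
  apply: le_trans (ler_normD _ _) _; rewrite mulr_natl mulr2n rmorphD /=.
  apply: lerD; apply: root.
    apply: le_trans (norm_ip_le (D := d) _) _.
      move=> c; rewrite -addrA -opprD [z n + _]addrC; apply: dle.
      by apply: Dlin => //; have [] := hz n.
    by rewrite -rmorphM lecR ler_wpM2r // sqn_ge0.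
  apply: le_trans (norm_ip_le (D := 0) _) _; first by move=> c; exact: sqn_ge0.
  by rewrite -rmorphM lecR subr0 ler_wpM2r // sqn_ge0.
apply/eqP; rewrite -normr_eq0; apply/negPn/negP => w0.
have wp : 0 < `|w| by rewrite lt_neqAle eq_sym w0 normr_ge0.
have wE := ge0_ReE (ltW wp); move: wp bound; rewrite wE ltcR.
move: (complex.Re _) => q q0 bound.
have v0 := sqn_ge0 v; have v1 : 0 < sqn v + 1 by rewrite ltr_wpDl.
have e0 : 0 < q ^+ 2 / (8 * (sqn v + 1)) by rewrite divr_gt0 ?exprn_gt0 // mulr_gt0.
have := bound _ e0; rewrite lecR leNgt => /negP; apply.
have qE : q = 2 * Num.sqrt (q ^+ 2 / 4).
  rewrite (_ : 4 = 2 ^+ 2); last by ring.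
  by rewrite -expr_div_n sqrtr_sqr ger0_norm ?divr_ge0 ?ltW //; field.
rewrite [X in _ < X]qE ltr_pM2l // ltr_sqrt; last by rewrite divr_gt0 ?exprn_gt0.
rewrite -mulrA ltr_pM2l ?exprn_gt0 // ltr_pdivrMl ?mulr_gt0 //.
by lra.
Qed.
End Projection.

(** * The Stein identity and the score *)

Section WordForms.
Context {R : realType} {M : tracial_wstar R} (L2 : forall m, l2_power M m) (n : nat).
Variable X : 'I_n -> M.
Local Notation wordm := (monalg.fmonom 'I_n).

Lemma evalT_diff_quot k (i : k.-tuple 'I_n) p :
  evalT X (L2 k.+1) (diff_quot i p) =
  lin (fun w : wordm => mcut i (fun us => puresq L2 k.+1 (map (prodw X) us)) w) p.
Proof.
rewrite -lin_diff_quot; apply: eq_lin => u; congr pure; apply/funext => l.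
rewrite (nth_map [::]) ?size_map ?size_tuple //.
by rewrite (nth_map (tnth u l)) ?size_tuple // -tnth_nth.
Qed.

Lemma ip_evalT_diff1 j p :
  ip _ (evalT X (L2 2) (diff_quot [tuple j] p)) (pure (L2 2) (fun _ => 1)) =
  lin (fun w : wordm => cut j (fun c d => tr M (prodw X c) * tr M (prodw X d)) w : R[i]^o) p.
Proof.
rewrite evalT_diff_quot /lin ip_suml; apply: eq_bigr => w _.
rewrite ipZl; congr (_ * _).
rewrite (mcut_morph (f := fun x => ip _ x (pure (L2 2) (fun _ => 1)))); last 2 first.
- exact: ip0l.
- by move=> x y; rewrite ipDl.
apply: eq_cut => c d.
by rewrite ip_pure big_ord_recl big_ord1 /= star1 !mulr1.
Qed.

Lemma tr_adjT_diff1 j p : tr_adjT X (diff_quot [tuple j] p) =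
  Num.conj (lin (fun w : wordm =>
    cut j (fun c d => tr M (prodw X c) * tr M (prodw X d)) w : R[i]^o) p).
Proof.
rewrite -ip_evalT_diff1 /tr_adjT /evalT ip_suml rmorph_sum; apply: eq_bigr => u _.
rewrite ipZl rmorphM /= ip_pure rmorph_prod; congr (_ * _); apply: eq_bigr => l _.
by rewrite star1 mulr1 (tr_star L2).
Qed.

Lemma eval_cyclic_diff j V : eval X (cyclic_diff j V) =
  lin (fun w : wordm => cut j (fun c d => prodw X (d ++ c)) w) V.
Proof.
rewrite evalE /cyclic_diff linear_sum; apply: eq_bigr => w _ /=.
rewrite linear_sum cutE scaler_sumr; apply: eq_bigr => l _ /=.
by rewrite lin_monomial.
Qed.

Lemma ncvar_sq (i : 'I_n) :
  ncvar R i ^+ 2 = mkmalgU (monalg.FMonom [:: i; i]) 1 :> ncpoly R n.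
Proof.
rewrite expr2 malgM_def fgmulUU mulr1; congr (mkmalgU _ _).
by rewrite !fmuE; exact: fmmulE.
Qed.

Lemma eval_cyclic_quad rho j :
  eval X (cyclic_diff j (V_quad n rho)) = (rho%:C)%C *: X j.
Proof.
rewrite eval_cyclic_diff /V_quad linearZ linear_sum /=.
under eq_bigr do rewrite ncvar_sq lin_monomial scale1r /= addr0.
rewrite (bigD1 j) //= big1 => [|i /negbTE ->]; last by rewrite addr0.
rewrite eqxx addr0 /= !prodw_cons prodw_nil !mulr1 -mulr2n -[X j *+ 2]scaler_nat scalerA.
by congr (_ *: _); rewrite -(rmorph_nat (real_complex R)) -rmorphM /= divfK ?pnatr_eq0.
Qed.

(** The Stein identity, conjugated and tested against a single word in one
    component: this is linear in the word, so that [cexp] can be applied to it. *)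
Lemma stein_word k rho (A : l2_array L2 n k) j u : selfadjoint (X j) ->
  is_stein_kernel (V_quad n rho) X A ->
  (rho%:C)%C * tr M (X j * prodw X u)
    - cut j (fun c d => tr M (prodw X c) * tr M (prodw X d)) u =
  \sum_(t : k.-tuple 'I_n)
    ip _ (mcut t (fun us => puresq L2 k.+1 (map (prodw X) us)) u) (A j t).
Proof.
move=> Xj stA.
pose P (i : 'I_n) : ncpoly R n := if i == j then mkmalgU (monalg.FMonom u) 1 else 0.
have := stA P; rewrite /ip2 [X in X - _ = _](bigD1 j) // [X in _ - X = _](bigD1 j) //.
rewrite [RHS](bigD1 j) // [X in _ + X - _ = _]big1 => [|i /negbTE ij]; last first.
  by rewrite /P ij evalE linear0 star0 mul0r linear0.
rewrite [X in _ - (_ + X) = _]big1 => [|i /negbTE ij]; last first.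
  by rewrite tr_adjT_diff1 /P ij linear0 rmorph0.
rewrite [X in _ = _ + X]big1 => [|i /negbTE ij]; last first.
  rewrite big1 // => t _.
  by rewrite /jacobian_iter evalT_diff_quot /P ij linear0 ip0r.
rewrite !addr0.
rewrite tr_adjT_diff1 /P eqxx eval_monomial scale1r lin_monomial eval_cyclic_quad.
move/(congr1 Num.conj).
rewrite rmorphB /= conjCK -(tr_star L2) starM starK starZ Xj conjR.
rewrite -scalerAl linearZ /= [_ *: cut _ _ _]scale1r => ->.
rewrite rmorph_sum; apply: eq_bigr => t _ /=; rewrite -ipC /jacobian_iter evalT_diff_quot.
by rewrite eqxx lin_monomial scale1r.
Qed.
End WordForms.

Section GeneratedAlgebra.
Context {R : realType} {M : tracial_wstar R} (n : nat).
Variable X : 'I_n -> M.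

Lemma gen_alg_wstar a : gen_alg X a -> gen_wstar X a.
Proof.
move=> [p _ <-] T cT hT; rewrite /eval; elim/big_rec: _ => [|w z _ IH] x.
  by rewrite -(scale0r 1) !repZ !scale0r linear0.
rewrite !repD !repZ linearD linearZ IH /=; congr (_ *: _ + _).
rewrite /eval_word; elim: (w : seq _) x => [|i u IHu] x; first by rewrite !big_nil !rep1.
by rewrite !big_cons !repM hT IHu.
Qed.
End GeneratedAlgebra.

Section Estimate.
Context {R : realType}.

(** The hypothesis bounds below |eta - z|^2 by |eta|^2 - K for z in D, and this distance
    can be made arbitrarily small. *)
Lemma closure_norm_bound (H : hilbert R) (D : set H) (eta : H) (K : R) :
  closure D eta ->
  (forall z, D z -> ip H z eta + Num.conj (ip H z eta) <= `|z| ^+ 2 + K%:C%C) ->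
  sqn eta <= K.
Proof.
move=> /closure_approx cl h; rewrite leNgt; apply/negP => lt.
have e0 : 0 < sqn eta - K by rewrite subr_gt0.
have [z Dz] := cl _ e0; apply/negP; rewrite -leNgt -lecR -sqnE ip_norm.
rewrite !(ipDl, ipDr, ipNl, ipNr) opprK rmorphB /= -(sqnE eta) ip_norm.
have := h z Dz; rewrite -ipC ip_norm => hz.
rewrite -subr_ge0; move: hz; rewrite -subr_ge0.
by congr (_ <= _); ring.
Qed.
End Estimate.

Section Main.
Context {R : realType} {M : tracial_wstar R}.
Variables (L2 : forall m, l2_power M m) (n k : nat) (X S : 'I_n -> M) (a b rho : R).
Hypotheses (hS : free_semicircular01 S) (hXS : free_from X S).
Hypotheses (Xsa : forall j, selfadjoint (X j)).
Hypotheses (b0 : 0 < b) (ab : rho * b ^+ 2 = 1 - a ^+ 2).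
Local Notation aC := (a%:C%C : R[i]).
Local Notation bC := (b%:C%C : R[i]).
Local Notation Y := (perturb X S aC bC).
Local Notation e := (cond_word X S aC bC).
Local Notation wordm := (monalg.fmonom 'I_n).

Let D : set (L2 1) := [set l2_of L2 (eval Y p) | p in [set: ncpoly R n]]%classic.

Lemma l2_of0 : l2_of L2 0 = 0.
Proof. by have := l2_of_comb L2 (-1) 0 0; rewrite scaler0 addr0 scaleN1r addNr. Qed.

Lemma poly_space_comb c u v : D u -> D v -> D (c *: u + v).
Proof.
move=> [p _ <-] [q _ <-]; exists (c *: p + q) => //.
by rewrite !evalE linearP l2_of_comb.
Qed.

Lemma poly_space0 : D 0.
Proof. by exists 0 => //; rewrite evalE linear0 l2_of0. Qed.

Lemma bC0 : bC != 0.
Proof. by rewrite fmorph_eq0 gt_eqF. Qed.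

(** The vector S_j / b satisfies the identity of a conjugate variable of Y by the
    Schwinger-Dyson equation, hence so does its projection on the closed span of
    the polynomials in Y. *)
Lemma conj_var_exists j : exists xi : L2 1, [/\ closure D xi,
  is_conj_var (L2 := L2) Y [tuple j] xi &
  forall p, ip _ (l2_of L2 (eval Y p)) xi = bC^-1 * tr M (eval Y p * S j)].
Proof.
have [xi cxi hxi] := orthogonal_projection (bC^-1 *: l2_of L2 (S j))
  poly_space0 poly_space_comb.
have eqxi p : ip _ (l2_of L2 (eval Y p)) xi = bC^-1 * tr M (eval Y p * S j).
  have /hxi : D (l2_of L2 (eval Y p)) by exists p.
  move/(congr1 Num.conj); rewrite -ipC rmorph0 ipDr ipNr => /subr0_eq <-.
  rewrite ipZr fmorphV /= conjR ip_l2_of; congr (_ * tr M (_ * _)).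
  by have [/(_ j)[-> _] _] := hS.
exists xi; split=> //; split.
  apply: closureS cxi => _ [p _ <-]; exists (eval Y p) => //.
  by apply: gen_alg_wstar; exists p.
move=> p; rewrite ipC eqxi [RHS]ipC ip_evalT_diff1; congr Num.conj.
rewrite trC evalE /lin mulr_sumr linear_sum mulr_sumr; apply: eq_bigr => w _.
rewrite -scalerAr linearZ /= mulrCA; congr (_ * _).
have := schwinger_dyson hS hXS aC bC j (w : seq _) (gen_alg1 X).
rewrite mulr1 => ->; rewrite mulKf ?bC0 //.
by apply: eq_cut => c d; rewrite mulr1.
Qed.

(** Since (1/b - rho b) b = a^2, the left-hand side is a^2 times the trace of the
    difference quotient of w at Y minus rho a tr (X_j E[w(Y)]), that is -a times the
    conditional expectation of the left-hand side of [stein_word]. *)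
Lemma score_word (A : l2_array L2 n k) j (w : seq 'I_n) :
  is_stein_kernel (V_quad n rho) X A ->
  bC^-1 * tr M (prodw Y w * S j) - (rho%:C)%C * tr M (prodw Y w * Y j) =
  - (aC ^+ k.+1 * \sum_(t : k.-tuple 'I_n)
      ip _ (mcut t (fun us => puresq L2 k.+1 (map e us)) w) (A j t)).
Proof.
move=> stA; pose kk := cut j (fun c d => kappa X S aC bC c * kappa X S aC bC d) w.
have hSj : tr M (S j * prodw Y w) = bC * kk.
  have := schwinger_dyson hS hXS aC bC j w (gen_alg1 X).
  by rewrite mulr1 => ->; congr (_ * _); apply: eq_cut => c d; rewrite mulr1.
have hXj : tr M (X j * prodw Y w) = tr M (X j * e w).
  by apply: tr_mul_cond_word => //; exact: gen_alg_gen.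
have hSt : (rho%:C)%C * tr M (X j * e w) - aC * kk = aC ^+ k * \sum_(t : k.-tuple 'I_n)
      ip _ (mcut t (fun us => puresq L2 k.+1 (map e us)) w) (A j t).
  transitivity (cexp aC (bC ^+ 2) (kappa X S aC bC) (fun u =>
    ((rho%:C)%C * tr M (X j * prodw X u) - cut j (fun c d => tr M (prodw X c) * tr M (prodw X d)) u : R[i]^o)) w).
    rewrite (cexpD _ _ _ (fun u => (rho%:C)%C * tr M (X j * prodw X u) : R[i]^o)).
    congr (_ + _).
      rewrite -(cexp_linear (W := R[i]^o) _ _ _
        (g := fun x : M => (rho%:C)%C * tr M (X j * x) : R[i]^o)) //.
      by move=> c x y; rewrite mulrDr -scalerAr linearD linearZ /= mulrDr mulrCA.
    rewrite -(cexp_linear (V := R[i]^o) (W := R[i]^o) _ _ _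
      (g := fun x : R[i]^o => - x)); last first.
      by move=> c x y; rewrite opprD scalerN.
    congr (- _); rewrite cexp_cut; congr (_ * _); apply: eq_cut => c d.
    have trl (x : R[i]) u : cexp aC (bC ^+ 2) (kappa X S aC bC)
        (fun v => x * tr M (prodw X v) : R[i]^o) u = x * kappa X S aC bC u.
      rewrite -(tr_cond_word _ _ hS hXS).
      rewrite -(cexp_linear (W := R[i]^o) _ _ _
        (g := fun y : M => x * tr M y : R[i]^o)) //.
      by move=> c' y z; rewrite linearD linearZ /= mulrDr mulrCA.
    under eq_cexp do rewrite trl mulrC.
    by rewrite trl mulrC.
  under eq_cexp do rewrite (stein_word _ (Xsa j) stA).
  rewrite mulr_sumr.
  have -> : cexp aC (bC ^+ 2) (kappa X S aC bC) (fun u => \sum_(t : k.-tuple 'I_n)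
      ip _ (mcut t (fun us => puresq L2 k.+1 (map (prodw X) us)) u) (A j t) : R[i]^o) w
    = \sum_(t : k.-tuple 'I_n) cexp aC (bC ^+ 2) (kappa X S aC bC) (fun u =>
      ip _ (mcut t (fun us => puresq L2 k.+1 (map (prodw X) us)) u) (A j t) : R[i]^o) w.
    elim: (index_enum _) => [|t r IH].
      by under eq_cexp do rewrite big_nil; rewrite big_nil cexp0.
    by under eq_cexp do rewrite big_cons; rewrite big_cons cexpD IH.
  apply: eq_bigr => t _.
  rewrite -(cexp_linear (W := R[i]^o) _ _ _ (g := fun x => ip _ x (A j t) : R[i]^o)).
    by rewrite (cexp_tensor L2 X S) ipZl.
  by move=> c x y; rewrite ipDl ipZl.
have hYj : tr M (Y j * prodw Y w) = aC * tr M (X j * e w) + bC * (bC * kk).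
  by rewrite {1}/perturb mulrDl linearD -!scalerAl !linearZ /= hSj hXj.
rewrite [tr M (_ * S j)]trC hSj [tr M (_ * Y j)]trC hYj mulKf ?bC0 //.
rewrite exprS -mulrA -hSt.
have -> : (rho%:C)%C * (aC * tr M (X j * e w) + bC * (bC * kk)) =
   aC * ((rho%:C)%C * tr M (X j * e w)) + ((rho * b ^+ 2)%:C)%C * kk.
  by rewrite rmorphM rmorphXn /=; ring.
by rewrite ab rmorphB rmorphXn rmorph1 /=; ring.
Qed.

Lemma score_pairing (A : l2_array L2 n k) j (xi : L2 1) (p : ncpoly R n) :
  is_stein_kernel (V_quad n rho) X A ->
  ip _ (l2_of L2 (eval Y p)) xi = bC^-1 * tr M (eval Y p * S j) ->
  ip _ (l2_of L2 (eval Y p)) (xi - l2_of L2 ((rho%:C)%C *: Y j)) =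
  - (aC ^+ k.+1 * \sum_(t : k.-tuple 'I_n) ip _ (lin (fun w : wordm =>
      mcut t (fun us => puresq L2 k.+1 (map e us)) w) p) (A j t)).
Proof.
move=> stA hxi; rewrite ipDr ipNr hxi ip_l2_of starZ conjR -scalerAr linearZ /=.
have Yj : star (Y j) = Y j.
  by apply: (perturb_selfadjoint hS Xsa); exact: conjR.
rewrite Yj evalE /lin !mulr_suml !linear_sum !mulr_sumr -sumrB.
transitivity (\sum_(w <- msupp p) mcoeff w p *
    (bC^-1 * tr M (prodw Y w * S j) - (rho%:C)%C * tr M (prodw Y w * Y j))).
  apply: eq_bigr => w _; rewrite -[_ *: _ * S j]scalerAl -[_ *: _ * Y j]scalerAl !trZ; ring.
under eq_bigr do rewrite (score_word _ _ stA).
under [in RHS]eq_bigr do rewrite ip_suml.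
rewrite -mulr_sumr exchange_big mulr_sumr -sumrN; apply: eq_bigr => w _ /=.
under [in RHS]eq_bigr do rewrite ipZl.
by rewrite -mulr_sumr; ring.
Qed.

(** By [score_pairing], Bessel and the inequality 0 <= |b^k W + c A|^2 with
    c = a^(k+1) / b^k, twice the real part of <z, eta> is at most |z|^2 plus the right-hand
    side, for all polynomials z in Y; and eta is a limit of such polynomials. *)
Lemma score_bound (A : l2_array L2 n k) j (xi : L2 1) :
  is_stein_kernel (V_quad n rho) X A -> closure D xi ->
  (forall p, ip _ (l2_of L2 (eval Y p)) xi = bC^-1 * tr M (eval Y p * S j)) ->
  sqn (xi - l2_of L2 ((rho%:C)%C *: Y j)) <=
    (a ^+ k.+1 / b ^+ k) ^+ 2 * \sum_(t : k.-tuple 'I_n) sqn (A j t).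
Proof.
move=> stA cxi hxi; set eta := xi - _.
have ceta : closure D eta.
  apply/closure_approx => r r0; have [z Dz hz] := (closure_approx _ _).1 cxi r r0.
  exists (- l2_of L2 ((rho%:C)%C *: Y j) + z).
    rewrite -scaleN1r; apply: poly_space_comb => //.
    exists ((rho%:C)%C *: mkmalgU (monalg.FMonom [:: j]) 1) => //.
    by rewrite evalE linearZ /= lin_monomial scale1r prodw_cons prodw_nil mulr1.
  by rewrite /eta opprD opprK addrA subrK.
apply: closure_norm_bound ceta _ => _ [p _ <-].
rewrite /eta (score_pairing stA (hxi p)).
pose W (t : k.-tuple 'I_n) := lin (fun w : wordm =>
  mcut t (fun us => puresq L2 k.+1 (map e us)) w) p.
set K := (_ / _) ^+ 2 * _.
have bge : 0 <= bC by rewrite lecR ltW.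
have bes : bC ^+ (2 * k) * (\sum_t `|W t| ^+ 2) <= `|l2_of L2 (eval Y p)| ^+ 2.
  exact: (bessel L2 hS hXS Xsa (conjR a) (conjR b) k p bge).
apply: le_trans (lerD bes (lexx _)).
rewrite -[X in - (_ * X) + _]/(\sum_t ip _ (W t) (A j t)).
rewrite -[X in _ + Num.conj (- (_ * X))]/(\sum_t ip _ (W t) (A j t)).
pose c := (a ^+ k.+1 / b ^+ k)%:C%C : R[i].
have : 0 <= \sum_(t : k.-tuple 'I_n) `|bC ^+ k *: W t + c *: A j t| ^+ 2.
  by apply: sumr_ge0 => t _; rewrite exprn_ge0.
rewrite -subr_ge0 => h; rewrite -subr_ge0; move: h; congr (0 <= _).
have cr : Num.conj c = c by exact: conjR.
have br : Num.conj (bC ^+ k) = bC ^+ k by rewrite rmorphXn /= conjR.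
have ac : c * bC ^+ k = aC ^+ k.+1.
  by rewrite /c rmorphM fmorphV !rmorphXn /= divfK // expf_neq0 // bC0.
have KE : K%:C%C = c ^+ 2 * \sum_(t : k.-tuple 'I_n) ip _ (A j t) (A j t).
  rewrite /K rmorphM rmorphXn /= rmorph_sum; congr (_ * _).
  by apply: eq_bigr => t _; rewrite -ip_norm sqnE.
have conjS : Num.conj (- (aC ^+ k.+1 * \sum_t ip _ (W t) (A j t))) =
    - (aC ^+ k.+1 * \sum_t ip _ (A j t) (W t)).
  rewrite rmorphN rmorphM rmorphXn /= conjR rmorph_sum; congr (- (_ * _)).
  by apply: eq_bigr => t _; rewrite /= -ipC.
rewrite conjS KE subr0 mulnC exprM -ac.
transitivity (\sum_t ((bC ^+ k) ^+ 2 * `|W t| ^+ 2 + c ^+ 2 * ip _ (A j t) (A j t)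
   + c * bC ^+ k * ip _ (W t) (A j t) + c * bC ^+ k * ip _ (A j t) (W t))).
  apply: eq_bigr => t _; rewrite !ip_norm !(ipDl, ipDr, ipZl, ipZr) cr br; ring.
by rewrite !big_split /= -!mulr_sumr; ring.
Qed.
End Main.

Section FinalBounds.
Context {R : realType} {M : tracial_wstar R}.
Variables (L2 : forall m, l2_power M m) (n k : nat).

Lemma sqn_norm (H : hilbert R) (x : H) : (complex.Re `|x|) ^+ 2 = sqn x.
Proof.
by apply: (@complexI R); rewrite rmorphXn /= -ge0_ReE // sqnE.
Qed.

Lemma norm2_sqr (A : l2_array L2 n k) :
  norm2 A ^+ 2 = \sum_(j < n) \sum_(t : k.-tuple 'I_n) sqn (A j t).
Proof.
have -> : norm2 A = Num.sqrt (\sum_(j < n) \sum_(t : k.-tuple 'I_n) sqn (A j t)).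
  rewrite /norm2 /ip2; congr Num.sqrt; apply: (@complexI R).
  rewrite rmorph_sum /= -ge0_ReE.
    by apply: eq_bigr => j _; rewrite rmorph_sum; apply: eq_bigr => t _; rewrite -ip_norm sqnE.
  by apply: sumr_ge0 => j _; apply: sumr_ge0 => t _; rewrite -ip_norm exprn_ge0.
rewrite sqr_sqrtr //; apply: sumr_ge0 => j _; apply: sumr_ge0 => t _; exact: sqn_ge0.
Qed.

(** The bound F is the Fisher information computed with the conjugate variables
    given by [conj_var_exists]; it does not depend on the kernel A, so that the
    infimum over A can be taken afterwards, even if there is no kernel. *)
Lemma fisher_le_stein (X S : 'I_n -> M) (a b rho : R) :
  free_semicircular01 S -> free_from X S -> (forall j, selfadjoint (X j)) ->
  0 < b -> rho * b ^+ 2 = 1 - a ^+ 2 ->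
  exists2 F : R, 0 <= F /\
    (fisher_information L2 (V_quad n rho) (perturb X S a%:C%C b%:C%C) <= F%:E)%E &
  forall A : l2_array L2 n k, is_stein_kernel (V_quad n rho) X A ->
    F <= (a ^+ k.+1 / b ^+ k) ^+ 2 * norm2 A ^+ 2.
Proof.
move=> hS hXS Xsa b0 ab.
have /choice[xi hxi] := conj_var_exists L2 a hS hXS b0.
exists (\sum_(j < n) sqn (xi j - l2_of L2 ((rho%:C)%C *: perturb X S a%:C%C b%:C%C j))).
  split; first by apply: sumr_ge0 => j _; exact: sqn_ge0.
  apply: ereal_inf_lbound; exists xi; first by move=> j /=; have [] := hxi j.
  by congr EFin; apply: eq_bigr => j _; rewrite sqn_norm eval_cyclic_quad.
move=> A stA; rewrite norm2_sqr mulr_sumr; apply: ler_sum => j _.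
by have [cxi _ exi] := hxi j; exact: (score_bound hS hXS Xsa b0 ab stA cxi exi).
Qed.
End FinalBounds.

Unset Implicit Arguments.

Theorem lemma4 (R : realType) (M : tracial_wstar R)
    (L2 : forall m : nat, l2_power M m) (n k : nat) (rho : R)
    (X S : 'I_n -> M)
    (hrho : 0 < rho) (hk : (1 <= k)%N)
    (hX : forall j : 'I_n, selfadjoint (X j))
    (hconj1 : bounded_conj_vars L2 1 X)
    (hconj2 : bounded_conj_vars L2 2 X)
    (hS : free_semicircular01 S)
    (hXS : free_from X S)
    (t : R) (ht : 0 < t) :
  ((1 / rho ^+ k)%:E
     * fisher_information L2 (V_quad n rho) (interpolate rho t X S)
   <= (expR (- 2 * (k.+1)%:R * t) / (1 - expR (- 2 * t)) ^+ k)%:E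
        * stein_discrepancy L2 k (V_quad n rho) X ^+ 2)%E.
Proof.
set a := expR (- t); set q := 1 - expR (- 2 * t).
have q0 : 0 < q by rewrite subr_gt0 expR_lt1; nra.
pose b := Num.sqrt q * (Num.sqrt rho)^-1.
have b0 : 0 < b by rewrite mulr_gt0 ?invr_gt0 ?sqrtr_gt0.
have b2 : b ^+ 2 = q / rho by rewrite exprMn exprVn !sqr_sqrtr ?ltW.
have a2 m : a ^+ (2 * m) = expR (- 2 * m%:R * t).
  by rewrite /a -expRM_natl; congr expR; rewrite natrM; ring.
have ab : rho * b ^+ 2 = 1 - a ^+ 2.
  by rewrite b2 mulrC divfK ?gt_eqF // -[2%N]muln1 a2 /q mulr1.
have [F [F0 FE] hF] := fisher_le_stein L2 k hS hXS hX b0 ab.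
set c := expR _ / _.
have c0 : 0 < c by rewrite divr_gt0 ?expR_gt0 // exprn_gt0.
have cE : (a ^+ k.+1 / b ^+ k) ^+ 2 = rho ^+ k * c.
  rewrite expr_div_n -!exprM mulnC a2 (mulnC k) exprM b2 expr_div_n /c -/q.
  by field; rewrite !expf_neq0 ?gt_eqF.
have rk : 0 < rho ^+ k by rewrite exprn_gt0.
have rc : 0 < rho ^+ k * c by exact: mulr_gt0.
(* Bounding the infimum itself rather than its square also covers its value +oo. *)
pose s := Num.sqrt (F / (rho ^+ k * c)).
have s0 : 0 <= s by exact: sqrtr_ge0.
have sI : (s%:E <= stein_discrepancy L2 k (V_quad n rho) X)%E.
  apply: le_ereal_inf_tmp => _ [A stA <-]; rewrite lee_fin.
  have A0 : 0 <= norm2 A by exact: sqrtr_ge0.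
  rewrite -(ler_pXn2r (n := 2)) ?nnegrE // sqr_sqrtr; last first.
    by rewrite divr_ge0 // mulr_ge0 // ltW.
  by rewrite ler_pdivrMr // mulrC -cE; exact: hF.
apply: (@le_trans _ _ (c * s ^+ 2)%:E).
  have -> : c * s ^+ 2 = 1 / rho ^+ k * F.
    rewrite sqr_sqrtr; last by rewrite divr_ge0 // mulr_ge0 // ltW.
    by field; rewrite !gt_eqF.
  by rewrite [leRHS]EFinM; apply: lee_wpmul2l => //; rewrite lee_fin divr_ge0 // ltW.
rewrite EFinM; apply: lee_wpmul2l; first by rewrite lee_fin ltW.
by rewrite expr2 EFinM expe2; apply: lee_pmul.
Qed.
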